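(* $\mathsf{TC}_{\omega^\omega}\leq_{\mathrm W}\mathsf{C}_{2^\omega}\star\mathsf{LL}_{\bm{\Sigma}^0_1}$, and consequently $\mathsf{TC}_{\omega^\omega}\leq^{\mathrm a}_{\mathrm W}\mathsf{LL}_{\bm{\Sigma}^0_1}$.
   Context: Weihrauch reducibility: for partial multi-valued functions $f,g$ between represented spaces, a realizer of $g$ is a partial $G$ on $\omega^\omega$ sending each name of each $x\in\mathrm{dom}(g)$ to a name of an element of $g(x)$. $f\leq_{\mathrm W}g$ if there are computable partial $\varphi,\psi$ on $\omega^\omega$ such that for every realizer $G$ of $g$, $p\mapsto\psi(\langle p,G(\varphi(p))\rangle)$ is a realizer of $f$. $f\leq^{\mathrm a}_{\mathrm W}g$ is defined in the same way with $\varphi,\psi$ arithmetical instead of computable. The compositional product $f\star g$ is (up to Weihrauch equivalence) the $\leq_{\mathrm W}$-greatest problem among $f_0\circ g_0$ with $f_0\leq_{\mathrm W}f$, $g_0\leq_{\mathrm W}g$ (apply $g$, then a computable operation, then $f$). An open subset of $\omega^\omega$ is named by an enumeration of a set $A\subseteq\omega^{<\omega}$ with the open set equal to $\{f:\exists\tau\prec f\ (\tau\in A)\}$. A Laver tree (always with empty stem) is a prefix-closed $T\subseteq\omega^{<\omega}$ containing $\langle\rangle$ such that every $\sigma\in T$ has infinitely many immediate successors in $T$; $[T]$ is the set of infinite paths. $\mathrm{LT}:\omega^\omega\to\{\text{Laver trees}\}$ is a total bijective representation of Laver trees, computably equivalent to the representation via characteristic functions. $\mathsf{LL}_{\bm{\Sigma}^0_1}:\bm{\Sigma}^0_1(\omega^\omega)\rightrightarrows\omega^\omega$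 maps an open set $A$ to $\{f:[\mathrm{LT}(f)]\subseteq A\ \lor\ [\mathrm{LT}(f)]\cap A=\emptyset\}$. $\mathsf{C}_{2^\omega}$ maps a tree $T\subseteq2^{<\omega}$ with $[T]\neq\emptyset$ to $[T]$ (any path is an admissible output). $\mathsf{TC}_{\omega^\omega}$ maps a tree $T\subseteq\omega^{<\omega}$ to $[T]$ if $[T]\neq\emptyset$, and to $\omega^\omega$ (any output allowed) otherwise. *)

(* Defs.v *)
(* Standard library only. *)
From Stdlib Require Import Arith Lia List.
From Stdlib Require Cantor.
From Stdlib Require Import Classical ClassicalEpsilon FunctionalExtensionality
  PropExtensionality ProofIrrelevance.
Import ListNotations.

Set Implicit Arguments.
Unset Strict Implicit.

Definition baire : Type := nat -> nat.

Definition prefix (f : baire) (n : nat) : list nat := map f (seq 0 n).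

Definition pr (a b : nat) : nat := Cantor.to_nat (a, b).
Definition pr1 (n : nat) : nat := fst (Cantor.of_nat n).
Definition pr2 (n : nat) : nat := snd (Cantor.of_nat n).

(* A bijection between [list nat] and [nat]. *)
Fixpoint encode (s : list nat) : nat :=
  match s with
  | [] => 0
  | x :: s' => S (pr x (encode s'))
  end.

Definition bpair (p q : baire) : baire :=
  fun n => if Nat.even n then p (Nat.div2 n) else q (Nat.div2 n).

(* Kleene's partial recursive functions relative to an oracle; several
   arguments are passed through the Cantor pairing. *)
Inductive code : Type :=
  | Zero | Succ | Fst | Snd
  | Query
  | Pair (c d : code)
  | Comp (c d : code)
  | Prec (c d : code)
  | Mu (c : code).

(* [eval p c a r]: with oracle [p], program [c] halts on input [a] with
   output [r].  In the case of [Prec], [s] is the sequence of intermediate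
   values of the recursion on [pr2 a] with parameter [pr1 a]. *)
Fixpoint eval (p : baire) (c : code) (a r : nat) : Prop :=
  match c with
  | Zero => r = 0
  | Succ => r = S a
  | Fst => r = pr1 a
  | Snd => r = pr2 a
  | Query => r = p a
  | Pair c d => exists x y, eval p c a x /\ eval p d a y /\ r = pr x y
  | Comp c d => exists x, eval p d a x /\ eval p c x r
  | Prec c d => exists s : nat -> nat,
      eval p c (pr1 a) (s 0)
      /\ (forall i, i < pr2 a -> eval p d (pr (pr1 a) (pr i (s i))) (s (S i)))
      /\ r = s (pr2 a)
  | Mu c =>
      eval p c (pr a r) 0
      /\ (forall m, m < r -> exists k, eval p c (pr a m) (S k))
  end.

Record pfun : Type := Pfun {
  graph :> baire -> baire -> Prop;
  graph_fun : forall p q q', graph p q -> graph p q' -> q = q'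
}.

(* As usual for partial functions on Baire space, the program is only
   constrained on the domain of [F]. *)
Definition computable (F : pfun) : Prop :=
  exists c, forall p q, F p q -> forall n, eval p c n (q n).

Definition decidable_rel (R : baire -> nat -> Prop) : Prop :=
  exists c, forall p a,
    (R p a /\ eval p c a 1) \/ (~ R p a /\ eval p c a 0).

(* Lightface Sigma^0_k relations on Baire space times the natural numbers
   ([k = 0] being the decidable ones). *)
Fixpoint Sigma0 (k : nat) (R : baire -> nat -> Prop) : Prop :=
  match k with
  | 0 => decidable_rel R
  | S k' => exists Q, Sigma0 k' Q
      /\ forall p a, R p a <-> exists m, ~ Q p (pr a m)
  end.

Definition arithmetical (F : pfun) : Prop :=
  exists k R, Sigma0 k R
    /\ forall p q, F p q -> forall n m, R p (pr n m) <-> q n = m.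

Record rep_space : Type := RepSpace {
  carrier :> Type;
  names : baire -> carrier -> Prop;
  names_fun : forall p x y, names p x -> names p y -> x = y;
  names_surj : forall x, exists p, names p x
}.

Definition rep_reducible (X : Type) (d d' : baire -> X -> Prop) : Prop :=
  exists F : pfun, computable F
    /\ forall p x, d p x -> exists q, F p q /\ d' q x.

Definition rep_equiv (X : Type) (d d' : baire -> X -> Prop) : Prop :=
  rep_reducible d d' /\ rep_reducible d' d.

(* Partial multi-valued functions; the domain consists of the points with at
   least one value. *)
Definition mvfun (X Y : rep_space) : Type := X -> Y -> Prop.

Definition mvdom (X Y : rep_space) (f : mvfun X Y) (x : X) : Prop :=
  exists y, f x y.

Definition mvcomp (X Y Z : rep_space) (f : mvfun Y Z) (g : mvfun X Y) :
    mvfun X Z :=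
  fun x z => (forall y, g x y -> mvdom f y) /\ exists y, g x y /\ f y z.

Definition realizer (X Y : rep_space) (f : mvfun X Y) (G : pfun) : Prop :=
  forall p x, names p x -> mvdom f x ->
    exists q y, G p q /\ names q y /\ f x y.

(* The partial function p |-> psi <p, G (phi p)>. *)
Definition sandwich (phi psi G : pfun) : pfun.
Proof.
  exists (fun p r => exists q s, phi p q /\ G q s /\ psi (bpair p s) r).
  intros p r r' (q & s & H1 & H2 & H3) (q' & s' & H1' & H2' & H3').
  assert (q = q') by (eapply graph_fun; eauto); subst q'.
  assert (s = s') by (eapply graph_fun; eauto); subst s'.
  eapply graph_fun; eauto.
Defined.

Definition reducible_by (C : pfun -> Prop) (X Y Z W : rep_space)
    (f : mvfun X Y) (g : mvfun Z W) : Prop :=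
  exists phi psi : pfun, C phi /\ C psi
    /\ forall G, realizer g G -> realizer f (sandwich phi psi G).

Definition le_W (X Y Z W : rep_space) (f : mvfun X Y) (g : mvfun Z W) : Prop :=
  reducible_by computable f g.

Definition le_aW (X Y Z W : rep_space) (f : mvfun X Y) (g : mvfun Z W) : Prop :=
  reducible_by arithmetical f g.

Notation "f ≤W g" := (le_W f g) (at level 70).
Notation "f ≤aW g" := (le_aW f g) (at level 70).

Lemma sig_ext (A : Type) (P : A -> Prop) (x y : {a | P a}) :
  proj1_sig x = proj1_sig y -> x = y.
Proof.
  destruct x as [x hx], y as [y hy]; simpl; intros <-.
  f_equal; apply proof_irrelevance.
Qed.

Lemma pred_ext (A : Type) (P Q : A -> Prop) : (forall a, P a <-> Q a) -> P = Q.
Proof.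
  intros H; apply functional_extensionality; intros a.
  apply propositional_extensionality, H.
Qed.

Lemma pr1_pr a b : pr1 (pr a b) = a.
Proof. unfold pr1, pr; now rewrite Cantor.cancel_of_to. Qed.

Lemma pr2_pr a b : pr2 (pr a b) = b.
Proof. unfold pr2, pr; now rewrite Cantor.cancel_of_to. Qed.

Lemma encode_inj s t : encode s = encode t -> s = t.
Proof.
  revert t; induction s as [|x s IH]; intros [|y t]; simpl; try discriminate.
  - easy.
  - intros [= H].
    pose proof (f_equal pr1 H) as H1; pose proof (f_equal pr2 H) as H2.
    rewrite !pr1_pr in H1; rewrite !pr2_pr in H2; subst; f_equal; auto.
Qed.

Lemma bpair_l p q n : bpair p q (2 * n) = p n.
Proof.
  unfold bpair; rewrite Nat.even_mul; cbn [Nat.even orb].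
  now rewrite Nat.div2_double.
Qed.

Lemma bpair_r p q n : bpair p q (S (2 * n)) = q n.
Proof.
  unfold bpair.
  rewrite Nat.even_succ, Nat.odd_mul; cbn [Nat.odd Nat.even negb andb].
  now rewrite Nat.div2_succ_double.
Qed.

Lemma bpair_inj p q p' q' : bpair p q = bpair p' q' -> p = p' /\ q = q'.
Proof.
  intros H; split; apply functional_extensionality; intros n.
  - now rewrite <- (bpair_l p q n), <- (bpair_l p' q' n), H.
  - now rewrite <- (bpair_r p q n), <- (bpair_r p' q' n), H.
Qed.

Definition baire_space : rep_space.
Proof.
  apply (@RepSpace baire (fun p x => p = x)).
  - congruence.
  - eauto.
Defined.

Definition subspace (X : rep_space) (P : X -> Prop) : rep_space.
Proof.
  apply (@RepSpace {x : X | P x} (fun p x => names p (proj1_sig x))).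
  - intros p x y H H'; apply sig_ext; eapply names_fun; eauto.
  - intros [x hx]; apply names_surj.
Defined.

Definition prod_space (X Y : rep_space) : rep_space.
Proof.
  apply (@RepSpace (X * Y)%type (fun r z => exists p q,
    r = bpair p q /\ names p (fst z) /\ names q (snd z))).
  - intros r [x y] [x' y'] (p & q & -> & H1 & H2) (p' & q' & E & H1' & H2').
    apply bpair_inj in E as [<- <-]; simpl in *.
    f_equal; eapply names_fun; eauto.
  - intros [x y].
    destruct (names_surj x) as [p hp], (names_surj y) as [q hq]; simpl; eauto 6.
Defined.

Definition charfun (A : nat -> Prop) : baire :=
  fun n => if excluded_middle_informative (A n) then 1 else 0.

(* Sets of finite sequences satisfying [P], named by characteristic
   functions. *)
Definition char_space (P : (list nat -> Prop) -> Prop) : rep_space.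
Proof.
  apply (@RepSpace {T : list nat -> Prop | P T} (fun p T => forall s,
    (proj1_sig T s -> p (encode s) = 1) /\ (~ proj1_sig T s -> p (encode s) = 0))).
  - intros p T U HT HU; apply sig_ext, pred_ext; intros s.
    destruct (HT s) as [H1 H2], (HU s) as [H3 H4].
    split; intros H; apply NNPP; intros H'.
    + rewrite (H1 H) in H4; now specialize (H4 H').
    + rewrite (H3 H) in H2; now specialize (H2 H').
  - intros [T HT]; exists (charfun (fun n => exists s, n = encode s /\ T s)).
    intros s; simpl; unfold charfun.
    destruct excluded_middle_informative as [(t & E & Ht)|H]; split; intros Hs; auto.
    + apply encode_inj in E as <-; contradiction.
    + exfalso; eauto.
Defined.

Definition is_tree (T : list nat -> Prop) : Prop :=
  forall s t, T (s ++ t) -> T s.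

Definition path (T : list nat -> Prop) (f : baire) : Prop :=
  forall n, T (prefix f n).

Definition tree_space : rep_space := char_space is_tree.

Definition binary_tree_space : rep_space :=
  char_space (fun T => is_tree T /\ forall s, T s -> Forall (fun i => i < 2) s).

Definition cantor_space : rep_space :=
  @subspace baire_space (fun f : baire => forall n, f n < 2).

Definition is_laver_tree (T : list nat -> Prop) : Prop :=
  is_tree T /\ T []
  /\ forall s, T s -> forall m, exists n, m <= n /\ T (s ++ [n]).

Definition laver_space : rep_space := char_space is_laver_tree.

Definition generated_open (A : list nat -> Prop) (f : baire) : Prop :=
  exists n, A (prefix f n).

(* The value 0 lists nothing, so that the empty set has an enumeration. *)
Definition enumerates (p : baire) (A : list nat -> Prop) : Prop :=
  forall s, A s <-> exists i, p i = S (encode s).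

Definition open_space : rep_space.
Proof.
  apply (@RepSpace {U : baire -> Prop | exists A, U = generated_open A}
    (fun p U => exists A, enumerates p A /\ proj1_sig U = generated_open A)).
  - intros p U V (A & HA & EU) (B & HB & EV); apply sig_ext.
    rewrite EU, EV; f_equal; apply pred_ext; intros s.
    now rewrite (HA s), (HB s).
  - intros [U [A E]].
    exists (fun i => if excluded_middle_informative (exists s, i = encode s /\ A s)
                     then S i else 0).
    exists A; split; [|exact E].
    intros s; split.
    + intros Hs; exists (encode s).
      destruct excluded_middle_informative as [_|H]; [easy|exfalso; eauto].
    + intros [i Hi].
      destruct excluded_middle_informative as [(t & -> & Ht)|H]; [|discriminate].
      injection Hi as Hi; now apply encode_inj in Hi as ->.
Defined.

Definition TC_baire : mvfun tree_space baire_space :=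
  fun T f => (exists g, path (proj1_sig T) g) -> path (proj1_sig T) f.

Definition C_cantor : mvfun binary_tree_space cantor_space :=
  fun T f => path (proj1_sig T) (proj1_sig f).

(* The definition of [LT] is immaterial: any total bijective representation
   computably equivalent to the one by characteristic functions qualifies. *)
Definition is_laver_coding (LT : baire -> laver_space) : Prop :=
  (forall f g, LT f = LT g -> f = g)
  /\ (forall T, exists f, LT f = T)
  /\ rep_equiv (fun f T => LT f = T) (@names laver_space).

Definition LL_Sigma01 (LT : baire -> laver_space) :
    mvfun open_space baire_space :=
  fun A f =>
    (forall g, path (proj1_sig (LT f)) g -> proj1_sig A g)
    \/ (forall g, path (proj1_sig (LT f)) g -> ~ proj1_sig A g).

Definition is_comp_product (X Y Z W V U : rep_space)
    (f : mvfun X Y) (g : mvfun Z W) (h : mvfun V U) : Prop :=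
  (exists (A B C : rep_space) (f0 : mvfun B C) (g0 : mvfun A B),
      f0 ≤W f /\ g0 ≤W g /\ h ≤W mvcomp f0 g0 /\ mvcomp f0 g0 ≤W h)
  /\ forall (A B C : rep_space) (f0 : mvfun B C) (g0 : mvfun A B),
      f0 ≤W f -> g0 ≤W g -> mvcomp f0 g0 ≤W h.

(* The partial continuous function with associate [c] (Kleene): the value at
   [n] is given by the first prefix of the argument on which [c] answers. *)
Definition assoc_app (c : baire) : pfun.
Proof.
  exists (fun q r => forall n, exists k,
    c (pr n (encode (prefix q k))) = S (r n)
    /\ forall j, j < k -> c (pr n (encode (prefix q j))) = 0).
  intros q r r' H H'; apply functional_extensionality; intros n.
  destruct (H n) as (k & Hk & Lk), (H' n) as (k' & Hk' & Lk').
  destruct (Nat.lt_trichotomy k k') as [L|[->|L]].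
  - rewrite (Lk' _ L) in Hk; discriminate.
  - congruence.
  - rewrite (Lk _ L) in Hk'; discriminate.
Defined.

(* An instance is an instance of [g] together with a continuous function
   sending every name of every solution to a name of an instance of [f]; the
   solution contains the name of the intermediate solution which is used.
   Theorem [comp_product_spec] below shows that this is the greatest
   composition. *)
Definition comp_product (X Y Z W : rep_space) (f : mvfun X Y) (g : mvfun Z W) :
    mvfun (prod_space baire_space Z) (prod_space baire_space Y) :=
  fun i o =>
    (forall q w, names q w -> g (snd i) w ->
       exists r x, assoc_app (fst i) q r /\ names r x /\ mvdom f x)
    /\ exists w r x,
         names (fst o) w /\ g (snd i) w
         /\ assoc_app (fst i) (fst o) r /\ names r x /\ f x (snd o).

Notation "f ⋆ g" := (comp_product f g) (at level 40, left associativity).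

Ltac simpl_pr := repeat (rewrite pr1_pr || rewrite pr2_pr).

Lemma eval_fun c : forall p a r r', eval p c a r -> eval p c a r' -> r = r'.
Proof.
  induction c as [| | | | |c1 IH1 c2 IH2|c1 IH1 c2 IH2|c1 IH1 c2 IH2|c1 IH1];
    simpl; intros p a r r'; try congruence.
  - intros (x & y & H1 & H2 & ->) (x' & y' & H1' & H2' & ->).
    now rewrite (IH1 _ _ _ _ H1 H1'), (IH2 _ _ _ _ H2 H2').
  - intros (x & H1 & H2) (x' & H1' & H2').
    rewrite (IH2 _ _ _ _ H1 H1') in H2; eauto.
  - intros (s & H0 & HS & ->) (t & H0' & HS' & ->).
    assert (E : forall i, i <= pr2 a -> s i = t i); [|auto].
    intros i; induction i as [|i IHi]; intros L; [eauto|].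
    specialize (HS i L); specialize (HS' i L).
    rewrite IHi in HS by lia; eauto.
  - intros [H0 HS] [H0' HS'].
    destruct (Nat.lt_trichotomy r r') as [L|[E|L]]; [|exact E|].
    + destruct (HS' _ L) as [k Hk]; discriminate (IH1 _ _ _ _ H0 Hk).
    + destruct (HS _ L) as [k Hk]; discriminate (IH1 _ _ _ _ H0' Hk).
Qed.

Definition pfun_of_code (c : code) : pfun.
Proof.
  exists (fun p q => forall n, eval p c n (q n)).
  intros p q q' H H'; apply functional_extensionality; intros n.
  eapply eval_fun; eauto.
Defined.

Lemma computable_of_code c : computable (pfun_of_code c).
Proof. exists c; auto. Qed.

Definition total_computable (F : baire -> nat -> nat) : Prop :=
  exists c, forall p a, eval p c a (F p a).

Section Total.
Local Notation tc := total_computable.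

Lemma tc_ext F G : (forall p a, F p a = G p a) -> tc F -> tc G.
Proof. intros E [c Hc]; exists c; intros p a; rewrite <- E; auto. Qed.

Lemma tc_succ F : tc F -> tc (fun p a => S (F p a)).
Proof. intros [c Hc]; exists (Comp Succ c); simpl; eauto. Qed.

Lemma tc_const k : tc (fun _ _ => k).
Proof.
  induction k as [|k IH]; [exists Zero; simpl; auto|now apply tc_succ].
Qed.

Lemma tc_pr1 F : tc F -> tc (fun p a => pr1 (F p a)).
Proof. intros [c Hc]; exists (Comp Fst c); simpl; eauto. Qed.

Lemma tc_pr2 F : tc F -> tc (fun p a => pr2 (F p a)).
Proof. intros [c Hc]; exists (Comp Snd c); simpl; eauto. Qed.

Lemma tc_query F : tc F -> tc (fun p a => p (F p a)).
Proof. intros [c Hc]; exists (Comp Query c); simpl; eauto. Qed.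

Lemma tc_pair F G : tc F -> tc G -> tc (fun p a => pr (F p a) (G p a)).
Proof. intros [c Hc] [d Hd]; exists (Pair c d); simpl; eauto 8. Qed.

Lemma pr_eta n : pr (pr1 n) (pr2 n) = n.
Proof.
  unfold pr, pr1, pr2; rewrite <- surjective_pairing; apply Cantor.cancel_to_of.
Qed.

Lemma tc_id : tc (fun _ a => a).
Proof.
  exists (Pair Fst Snd); simpl; intros p a; exists (pr1 a), (pr2 a).
  now rewrite pr_eta.
Qed.

Lemma tc_comp F G : tc F -> tc G -> tc (fun p a => F p (G p a)).
Proof. intros [c Hc] [d Hd]; exists (Comp c d); simpl; eauto. Qed.

Lemma tc_rec F G H : tc F -> tc G -> tc H ->
  tc (fun p a => nat_rect (fun _ => nat) (F p a)
                   (fun i v => G p (pr a (pr i v))) (H p a)).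
Proof.
  intros [c Hc] [d Hd] [e He].
  exists (Comp (Prec c d) (Pair (Pair Fst Snd) e)); simpl; intros p a.
  exists (pr a (H p a)); split.
  - exists a, (H p a); repeat split; auto.
    exists (pr1 a), (pr2 a); now rewrite pr_eta.
  - exists (fun m => nat_rect (fun _ => nat) (F p a)
                       (fun i v => G p (pr a (pr i v))) m).
    rewrite pr1_pr, pr2_pr; simpl; auto.
Qed.

Lemma tc_case F G H : tc F -> tc G -> tc H ->
  tc (fun p a => match F p a with 0 => G p a | S k => H p (pr a k) end).
Proof.
  intros HF HG HH.
  eapply tc_ext; [|apply tc_rec with (F := G) (H := F)
    (G := fun p b => H p (pr (pr1 b) (pr1 (pr2 b))))]; auto.
  - intros p a; simpl; destruct (F p a); simpl; [easy|].
    now rewrite !pr2_pr, !pr1_pr.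
  - apply tc_comp; auto.
    apply tc_pair; [apply tc_pr1, tc_id|apply tc_pr1, tc_pr2, tc_id].
Qed.

Lemma tc_pred F : tc F -> tc (fun p a => pred (F p a)).
Proof.
  intros HF.
  eapply tc_ext; [|apply tc_case with (F := F) (G := fun _ _ => 0)
    (H := fun _ b => pr2 b)]; auto using tc_const, tc_pr2, tc_id.
  intros p a; simpl; destruct (F p a); simpl; now rewrite ?pr2_pr.
Qed.

Lemma tc_even F : tc F -> tc (fun p a => if Nat.even (F p a) then 0 else 1).
Proof.
  intros HF.
  eapply tc_ext; [|apply tc_rec with (F := fun _ _ => 0) (H := F)
    (G := fun _ b => match pr2 (pr2 b) with 0 => 1 | S k => 0 end)];
    auto using tc_const.
  - intros p a; simpl.
    induction (F p a) as [|n IH]; [easy|].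
    cbn [nat_rect]; rewrite IH, !pr2_pr, Nat.even_succ, <- Nat.negb_even.
    now destruct (Nat.even n).
  - apply tc_case with (G := fun _ _ => 1) (H := fun _ _ => 0);
      auto using tc_const, tc_pr2, tc_id.
Qed.

Lemma tc_div2 F : tc F -> tc (fun p a => Nat.div2 (F p a)).
Proof.
  intros HF.
  eapply tc_ext; [|apply tc_rec with (F := fun _ _ => 0) (H := F)
    (G := fun _ b => match (if Nat.even (pr1 (pr2 b)) then 0 else 1) with
                     | 0 => pr2 (pr2 b)
                     | S k => S (pr2 (pr2 (pr1 (pr b k)))) end)];
    auto using tc_const.
  - intros p a; simpl.
    induction (F p a) as [|n IH]; [easy|].
    cbn [nat_rect]; rewrite IH.
    destruct (Nat.Even_or_Odd n) as [[m E]|[m E]].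
    + assert (Ev : Nat.even n = true) by (apply Nat.even_spec; eexists; eauto).
      rewrite !pr2_pr, pr1_pr, Ev, E.
      now rewrite Nat.div2_double, Nat.div2_succ_double.
    + assert (Ev : Nat.even n = false).
      { rewrite <- Nat.negb_odd; apply Bool.negb_false_iff, Nat.odd_spec.
        eexists; eauto. }
      rewrite !pr2_pr, !pr1_pr, Ev, ?pr1_pr, ?pr2_pr, E.
      replace (S (2 * m + 1)) with (2 * S m) by lia.
      now rewrite Nat.add_1_r, Nat.div2_succ_double, Nat.div2_double.
  - apply tc_case with (H := fun _ b => S (pr2 (pr2 (pr1 b))));
      auto using tc_succ, tc_even, tc_pr1, tc_pr2, tc_id.
Qed.

Lemma tc_double F : tc F -> tc (fun p a => 2 * F p a).
Proof.
  intros HF.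
  eapply tc_ext; [|apply tc_rec with (F := fun _ _ => 0) (H := F)
    (G := fun _ b => S (S (pr2 (pr2 b))))];
    auto using tc_const, tc_succ, tc_pr2, tc_id.
  intros p a; simpl.
  induction (F p a) as [|n IH]; [easy|].
  cbn [nat_rect]; rewrite IH, !pr2_pr; lia.
Qed.

End Total.

#[local] Hint Resolve tc_id tc_const tc_succ tc_pr1 tc_pr2 tc_query tc_pair
  tc_pred tc_even tc_div2 tc_double : tc.

Lemma tc_if F G H : total_computable F -> total_computable G ->
  total_computable H ->
  total_computable (fun p a => match F p a with 0 => G p a | S _ => H p a end).
Proof.
  intros HF HG HH.
  eapply tc_ext; [|apply tc_case with (F := F) (G := G)
    (H := fun p b => H p (pr1 b))]; auto using tc_comp with tc.
  intros p a; simpl; destruct (F p a); now rewrite ?pr1_pr.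
Qed.

Lemma bpair_if p q n :
  bpair p q n =
  match (if Nat.even n then 0 else 1) with
  | 0 => p (Nat.div2 n) | S _ => q (Nat.div2 n)
  end.
Proof. unfold bpair; now destruct (Nat.even n). Qed.

Fixpoint subst (d c : code) : code :=
  match c with
  | Zero | Succ | Fst | Snd => c
  | Query => d
  | Pair c1 c2 => Pair (subst d c1) (subst d c2)
  | Comp c1 c2 => Comp (subst d c1) (subst d c2)
  | Prec c1 c2 => Prec (subst d c1) (subst d c2)
  | Mu c1 => Mu (subst d c1)
  end.

Lemma eval_subst p q d : (forall n, eval p d n (q n)) ->
  forall c a r, eval q c a r -> eval p (subst d c) a r.
Proof.
  intros Hd c.
  induction c as [| | | | |c1 IH1 c2 IH2|c1 IH1 c2 IH2|c1 IH1 c2 IH2|c1 IH1];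
    simpl; intros a r; auto.
  - intros ->; auto.
  - intros (x & y & H1 & H2 & ->); eauto 8.
  - intros (x & H1 & H2); eauto.
  - intros (s & H0 & HS & ->); exists s; auto 6.
  - intros [H0 HS]; split; auto.
    intros m L; destruct (HS m L) as [k Hk]; eauto.
Qed.

Lemma join_codes c d : exists e, forall p q r,
  (forall n, eval p c n (q n)) -> (forall n, eval p d n (r n)) ->
  forall n, eval p e n (bpair q r n).
Proof.
  destruct (tc_pair (tc_div2 tc_id) (tc_even tc_id)) as [i Hi].
  exists (Comp (Prec c (Comp d Fst)) i); intros p q r Hq Hr n.
  exists (pr (Nat.div2 n) (if Nat.even n then 0 else 1)); split; [apply Hi|].
  exists (fun m => match m with 0 => q (Nat.div2 n) | _ => r (Nat.div2 n) end).
  rewrite pr1_pr, pr2_pr, bpair_if; repeat split; auto.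
  intros k _; exists (Nat.div2 n); split; [|apply Hr].
  simpl; now rewrite pr1_pr.
Qed.

Lemma left_code : exists e, forall p q n, eval (bpair p q) e n (p n).
Proof.
  destruct (tc_query (tc_double tc_id)) as [e He].
  exists e; intros p q n; now rewrite <- (bpair_l p q n).
Qed.

Lemma right_code : exists e, forall p q n, eval (bpair p q) e n (q n).
Proof.
  destruct (tc_query (tc_succ (tc_double tc_id))) as [e He].
  exists e; intros p q n; now rewrite <- (bpair_r p q n).
Qed.

Lemma realizer_exists (X Y : rep_space) (f : mvfun X Y) :
  exists G, realizer f G
    /\ forall p q, G p q -> exists x y, names p x /\ names q y /\ f x y.
Proof.
  pose (R p q := exists x y, names p x /\ names q y /\ @names Y q y /\ f x y).
  pose (h p := epsilon (inhabits (fun _ => 0)) (R p)).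
  assert (Gf : forall p q q', (R p q /\ q = h p) -> (R p q' /\ q' = h p) -> q = q')
    by (intros p q q' [_ ->] [_ ->]; easy).
  exists (Pfun Gf); split.
  - intros p x Hp [y Hy].
    destruct (names_surj y) as [q Hq].
    assert (E : R p (h p)).
    { apply epsilon_spec; exists q, x, y; auto. }
    pose proof E as (x' & y' & Hx' & Hy' & _ & Hf).
    rewrite (names_fun Hx' Hp) in Hf.
    exists (h p), y'; simpl; auto.
  - intros p q [(x & y & H1 & H2 & _ & H3) _]; eauto 6.
Qed.

Lemma realizer_exists_at (X Y : rep_space) (f : mvfun X Y) p0 q0 x0 y0 :
  names p0 x0 -> names q0 y0 -> f x0 y0 ->
  exists G, realizer f G /\ forall q, G p0 q -> q = q0.
Proof.
  intros Hp Hq Hf.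
  destruct (realizer_exists f) as (G & HG & _).
  assert (Gf : forall p q q', (p = p0 /\ q = q0 \/ p <> p0 /\ G p q) ->
    (p = p0 /\ q' = q0 \/ p <> p0 /\ G p q') -> q = q').
  { intros p q q' [[-> ->]|[N H]] [[E ->]|[N' H']]; try easy.
    eapply graph_fun; eauto. }
  exists (Pfun Gf); split.
  - intros p x Hx Hd; simpl.
    destruct (classic (p = p0)) as [->|N].
    + rewrite (names_fun Hx Hp); exists q0, y0; auto.
    + destruct (HG p x Hx Hd) as (q & y & H1 & H2 & H3); exists q, y; auto.
  - intros q [[_ ->]|[N _]]; easy.
Qed.

Lemma le_W_pointwise (X Y Z W : rep_space) (f : mvfun X Y) (g : mvfun Z W) :
  f ≤W g <->
  exists c d, forall p x, names p x -> mvdom f x ->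
    exists p' z, (forall n, eval p c n (p' n)) /\ names p' z /\ mvdom g z
      /\ forall q w, names q w -> g z w ->
           exists r y, (forall n, eval (bpair p q) d n (r n))
                       /\ names r y /\ f x y.
Proof.
  split.
  - intros (phi & psi & [c Hc] & [d Hd] & H).
    exists c, d; intros p x Hp Hx.
    destruct (realizer_exists g) as (G & HG & HGd).
    destruct (H G HG p x Hp Hx) as (_ & _ & (p' & s & Hphi & Hs & _) & _ & _).
    destruct (HGd _ _ Hs) as (z & w & Hz & Hw & Hg).
    exists p', z; split; [|split; [|split]].
    + now apply Hc.
    + exact Hz.
    + now exists w.
    + intros q w' Hq Hg'.
      destruct (realizer_exists_at Hz Hq Hg') as (G' & HG' & E).
      destruct (H G' HG' p x Hp Hx)
        as (r & y & (p2 & q2 & H1 & H2 & H3) & Hr & Hy).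
      rewrite (graph_fun H1 Hphi) in H2; rewrite (E _ H2) in H3.
      exists r, y; split; [now apply Hd|auto].
  - intros (c & d & H).
    exists (pfun_of_code c), (pfun_of_code d).
    split; [apply computable_of_code|split; [apply computable_of_code|]].
    intros G HG p x Hp Hx.
    destruct (H p x Hp Hx) as (p' & z & Hc & Hz & Hg & K).
    destruct (HG p' z Hz Hg) as (q & w & HGq & Hq & Hw).
    destruct (K q w Hq Hw) as (r & y & Hd & Hr & Hf).
    exists r, y; split; [|split]; auto.
    exists p', q; auto.
Qed.

Lemma le_W_of_iff (X Y : rep_space) (f g : mvfun X Y) :
  (forall x y, f x y <-> g x y) -> f ≤W g.
Proof.
  intros E; apply le_W_pointwise.
  destruct right_code as [d Hd], (tc_query tc_id) as [c Hc].
  exists c, d; intros p x Hp [y Hy].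
  exists p, x; split; [|split; [|split]]; auto.
  - exists y; now apply E.
  - intros q w Hq Hw; exists q, w; split; [|split]; auto.
    now apply E.
Qed.

(** Evaluation with a partial oracle and a bound on the searches; the value 0
    means that no result is available. *)

Fixpoint feval (o : nat -> nat) (s : nat) (c : code) (a : nat) : nat :=
  match c with
  | Zero => 1
  | Succ => S (S a)
  | Fst => S (pr1 a)
  | Snd => S (pr2 a)
  | Query => o a
  | Pair c d =>
      match feval o s c a with
      | 0 => 0
      | S x => match feval o s d a with 0 => 0 | S y => S (pr x y) end
      end
  | Comp c d => match feval o s d a with 0 => 0 | S x => feval o s c x end
  | Prec c d =>
      nat_rect (fun _ => nat) (feval o s c (pr1 a))
        (fun i v => match v with
                    | 0 => 0
                    | S x => feval o s d (pr (pr1 a) (pr i x))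
                    end) (pr2 a)
  | Mu c =>
      (* 0: failure, 1: still searching, S (S r): result r *)
      pred (nat_rect (fun _ => nat) 1
        (fun i v => match v with
                    | 0 => 0
                    | S v' =>
                        match v' with
                        | 0 => match feval o s c (pr a i) with
                               | 0 => 0
                               | S x => match x with 0 => S (S i) | S _ => 1 end
                               end
                        | S _ => v
                        end
                    end) s)
  end.

Lemma feval_sound p o s : (forall a v, o a = S v -> v = p a) ->
  forall c a r, feval o s c a = S r -> eval p c a r.
Proof.
  intros Ho c.
  induction c as [| | | | |c1 IH1 c2 IH2|c1 IH1 c2 IH2|c1 IH1 c2 IH2|c1 IH1];
    simpl; intros a r; try (intros [= <-]; reflexivity).
  - apply Ho.
  - destruct (feval o s c1 a) as [|x] eqn:E1; [easy|].
    destruct (feval o s c2 a) as [|y] eqn:E2; [easy|].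
    intros [= <-]; eauto 8.
  - destruct (feval o s c2 a) as [|x] eqn:E2; [easy|]; eauto.
  - set (h := nat_rect _ _ _).
    intros E.
    assert (P : forall i, i <= pr2 a -> h i <> 0).
    { assert (Z : forall i j, h i = 0 -> h (j + i) = 0).
      { intros i j H; induction j as [|j IHj]; [easy|].
        simpl; fold h; now rewrite IHj. }
      intros i L H; apply (Z _ (pr2 a - i)) in H.
      replace (pr2 a - i + i) with (pr2 a) in H by lia; congruence. }
    exists (fun i => pred (h i)); split; [|split].
    + apply IH1; change (h 0 = S (pred (h 0))).
      specialize (P 0 ltac:(lia)); destruct (h 0); easy.
    + intros i L; apply IH2.
      pose proof (P i ltac:(lia)) as Pi; pose proof (P (S i) L) as PS.
      change (h (S i)) with
        (match h i with 0 => 0 | S x => feval o s c2 (pr (pr1 a) (pr i x)) end)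
        in *.
      destruct (h i) as [|x]; [easy|]; simpl.
      destruct (feval o s c2 _); easy.
    + now rewrite E.
  - set (h := nat_rect _ _ _).
    intros E.
    assert (K : forall m,
      (h m = 1 -> forall j, j < m -> exists k, eval p c1 (pr a j) (S k))
      /\ (forall x, h m = S (S x) -> eval p c1 (pr a x) 0
            /\ forall j, j < x -> exists k, eval p c1 (pr a j) (S k))).
    { intros m; induction m as [|m [IHa IHb]]; [split; [intros; lia|easy]|].
      change (h (S m)) with
        (match h m with
         | 0 => 0
         | S v' =>
             match v' with
             | 0 => match feval o s c1 (pr a m) with
                    | 0 => 0
                    | S x => match x with 0 => S (S m) | S _ => 1 end
                    end
             | S _ => h m
             end
         end).
      destruct (h m) as [|[|v]]; [easy| |split; [easy|auto]].
      destruct (feval o s c1 (pr a m)) as [|[|x]] eqn:F; [easy| |].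
      - split; [easy|]; intros x [= <-]; auto.
      - split; [|easy]; intros _ j L.
        destruct (Nat.eq_dec j m) as [->|N]; [eauto|].
        apply IHa; lia. }
    apply (K s); destruct (h s); simpl in *; congruence.
Qed.

Lemma feval_complete p : forall c a r, eval p c a r ->
  exists k, forall o s, k <= s -> (forall i, i < k -> o i = S (p i)) ->
    feval o s c a = S r.
Proof.
  intros c.
  induction c as [| | | | |c1 IH1 c2 IH2|c1 IH1 c2 IH2|c1 IH1 c2 IH2|c1 IH1];
    simpl; intros a r.
  1-4: intros ->; exists 0; auto.
  - intros ->; exists (S a); auto.
  - intros (x & y & H1 & H2 & ->).
    destruct (IH1 _ _ H1) as [k1 K1], (IH2 _ _ H2) as [k2 K2].
    exists (k1 + k2); intros o s L Ho.
    rewrite K1, K2; auto; try lia; intros; apply Ho; lia.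
  - intros (x & H1 & H2).
    destruct (IH2 _ _ H1) as [k1 K1], (IH1 _ _ H2) as [k2 K2].
    exists (k1 + k2); intros o s L Ho.
    rewrite K1, K2; auto; try lia; intros; apply Ho; lia.
  - intros (t & H0 & HS & ->).
    induction (pr2 a) as [|n IHn].
    + destruct (IH1 _ _ H0) as [k K]; exists k; auto.
    + destruct IHn as [k1 K1]; [auto|].
      destruct (IH2 _ _ (HS n ltac:(lia))) as [k2 K2].
      exists (k1 + k2); intros o s L Ho; simpl.
      rewrite K1, K2; auto; try lia; intros; apply Ho; lia.
  - intros [H0 HS].
    assert (K : exists k, forall o s, k <= s ->
      (forall i, i < k -> o i = S (p i)) ->
      feval o s c1 (pr a r) = 1
      /\ forall m, m < r -> exists x, feval o s c1 (pr a m) = S (S x)).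
    { destruct (IH1 _ _ H0) as [k0 K0].
      assert (K : exists k, forall o s, k <= s ->
        (forall i, i < k -> o i = S (p i)) ->
        forall m, m < r -> exists x, feval o s c1 (pr a m) = S (S x)).
      { clear H0 k0 K0; induction r as [|r IHr]; [exists 0; intros; lia|].
        destruct IHr as [k1 K1]; [auto|].
        destruct (HS r ltac:(lia)) as [x Hx].
        destruct (IH1 _ _ Hx) as [k2 K2].
        exists (k1 + k2); intros o s L Ho m Lm.
        destruct (Nat.eq_dec m r) as [->|N].
        - exists x; apply K2; [lia|]; intros; apply Ho; lia.
        - apply K1; try lia; intros; apply Ho; lia. }
      destruct K as [k1 K1].
      exists (k0 + k1); intros o s L Ho; split.
      - apply K0; [lia|]; intros; apply Ho; lia.
      - apply K1; [lia|]; intros; apply Ho; lia. }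
    destruct K as [k K].
    exists (k + S r); intros o s L Ho.
    destruct (K o s ltac:(lia) ltac:(intros; apply Ho; lia)) as [A B].
    set (h := nat_rect _ _ _).
    assert (h1 : forall m, m <= r -> h m = 1).
    { intros m; induction m as [|m IHm]; intros Lm; [easy|].
      simpl; fold h; rewrite IHm by lia.
      destruct (B m Lm) as [x ->]; easy. }
    assert (h2 : forall j, h (j + S r) = S (S r)).
    { intros j; induction j as [|j IHj].
      - simpl; fold h; now rewrite h1, A by lia.
      - simpl; simpl in IHj; fold h in IHj |- *; now rewrite IHj. }
    specialize (h2 (s - S r)).
    replace (s - S r + S r) with s in h2 by lia; now rewrite h2.
Qed.

Lemma tc_feval (o : baire -> nat -> nat -> nat) (c : code) :
  total_computable (fun p x => o p (pr1 x) (pr2 x)) ->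
  total_computable (fun p x => feval (o p (pr1 x)) (pr1 x) c (pr2 x)).
Proof.
  intros Ho.
  assert (C : forall e F G,
    total_computable (fun p x => feval (o p (pr1 x)) (pr1 x) e (pr2 x)) ->
    total_computable F -> total_computable G ->
    total_computable (fun p x => feval (o p (F p x)) (F p x) e (G p x))).
  { intros e F G H HF HG.
    eapply tc_ext; [|apply (tc_comp H (tc_pair HF HG))].
    intros p a; simpl; now rewrite pr1_pr, pr2_pr. }
  induction c as [| | | | |c1 IH1 c2 IH2|c1 IH1 c2 IH2|c1 IH1 c2 IH2|c1 IH1];
    simpl; auto with tc.
  - eapply tc_ext; [|apply tc_case with (G := fun _ _ => 0) (F := fun p x =>
        feval (o p (pr1 x)) (pr1 x) c1 (pr2 x))
      (H := fun p b => match feval (o p (pr1 (pr1 b))) (pr1 (pr1 b)) c2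
                               (pr2 (pr1 b)) with
                       | 0 => 0
                       | S y => S (pr (pr2 (pr1 (pr b y))) (pr2 (pr b y)))
                       end)]; auto with tc.
    + intros p x; simpl; destruct feval; [easy|].
      rewrite pr1_pr; destruct feval; [easy|].
      now rewrite ?pr1_pr, ?pr2_pr.
    + apply tc_case with (G := fun _ _ => 0)
        (H := fun _ b => S (pr (pr2 (pr1 b)) (pr2 b))); auto 10 with tc.
  - eapply tc_ext; [|apply tc_case with (G := fun _ _ => 0) (F := fun p x =>
        feval (o p (pr1 x)) (pr1 x) c2 (pr2 x))
      (H := fun p b => feval (o p (pr1 (pr1 b))) (pr1 (pr1 b)) c1 (pr2 b))];
      auto with tc.
    intros p x; simpl; destruct feval; [easy|].
    now rewrite ?pr1_pr, ?pr2_pr.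
  - eapply tc_ext; [|apply tc_rec with (H := fun p x => pr2 (pr2 x))
      (F := fun p x => feval (o p (pr1 x)) (pr1 x) c1 (pr1 (pr2 x)))
      (G := fun p b => match pr2 (pr2 b) with
                       | 0 => 0
                       | S x => feval (o p (pr1 (pr1 (pr1 (pr b x)))))
                           (pr1 (pr1 (pr1 (pr b x)))) c2
                           (pr (pr1 (pr2 (pr1 (pr1 (pr b x)))))
                             (pr (pr1 (pr2 (pr1 (pr b x)))) (pr2 (pr b x))))
                       end)]; auto with tc.
    + intros p x; simpl.
      induction (pr2 (pr2 x)) as [|n IH]; [easy|].
      cbn [nat_rect]; rewrite IH.
      set (v := nat_rect _ _ _ n); clearbody v.
      simpl_pr; destruct v; now simpl_pr.
    + apply tc_case with (G := fun _ _ => 0)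
        (H := fun p b => feval (o p (pr1 (pr1 (pr1 b)))) (pr1 (pr1 (pr1 b))) c2
           (pr (pr1 (pr2 (pr1 (pr1 b)))) (pr (pr1 (pr2 (pr1 b))) (pr2 b))));
        auto with tc.
      apply C; auto 10 with tc.
  - apply tc_pred.
    eapply tc_ext; [|apply tc_rec with (H := fun p x => pr1 x)
      (F := fun p x => 1)
      (G := fun p b =>
        match pr2 (pr2 b) with
        | 0 => 0
        | S _ =>
          match pred (pr2 (pr2 b)) with
          | 0 =>
            match feval (o p (pr1 (pr1 b))) (pr1 (pr1 b)) c1
                    (pr (pr2 (pr1 b)) (pr1 (pr2 b))) with
            | 0 => 0
            | S _ =>
              match pred (feval (o p (pr1 (pr1 b))) (pr1 (pr1 b)) c1
                    (pr (pr2 (pr1 b)) (pr1 (pr2 b)))) with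
              | 0 => S (S (pr1 (pr2 b)))
              | S _ => 1
              end
            end
          | S _ => pr2 (pr2 b)
          end
        end)]; auto with tc.
    + intros p x; simpl.
      generalize (pr1 x) at 1 4; intros n.
      induction n as [|n IH]; [easy|].
      cbn [nat_rect]; rewrite IH.
      set (v := nat_rect _ _ _ n); clearbody v.
      simpl_pr.
      destruct v as [|[|v]]; simpl; try easy; simpl_pr.
      destruct feval as [|[|y]]; easy.
    + repeat first [apply tc_if | apply tc_pred]; auto 10 with tc.
      all: apply C; auto 10 with tc.
Qed.

(** Every computable function of a pair has, uniformly in the first
    component, an associate for the second component. *)

Definition tl_code (n : nat) : nat := match n with 0 => 0 | S k => pr2 k end.
Definition hd_code (n : nat) : nat := match n with 0 => 0 | S k => S (pr1 k) end.

Definition lookup (n i : nat) : nat :=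
  hd_code (nat_rect (fun _ => nat) n (fun _ => tl_code) i).

Lemma lookup_encode s i :
  lookup (encode s) i = match nth_error s i with None => 0 | Some x => S x end.
Proof.
  unfold lookup.
  assert (E : nat_rect (fun _ => nat) (encode s) (fun _ => tl_code) i
    = encode (skipn i s)).
  { revert s; induction i as [|i IH]; intros s; [easy|].
    assert (F : tl_code (encode (skipn i s)) = encode (skipn (S i) s)).
    { clear IH; revert s; induction i as [|i IH]; intros [|x s]; try easy.
      - simpl; now rewrite pr2_pr.
      - apply IH. }
    cbn [nat_rect]; now rewrite IH, F. }
  rewrite E; clear E; revert s; induction i as [|i IH]; intros [|x s]; try easy.
  - simpl; now rewrite pr1_pr.
  - apply IH.
Qed.

Lemma length_encode s : length s <= encode s.
Proof.
  induction s as [|x s IH]; [easy|]; simpl; unfold pr.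
  pose proof (Cantor.to_nat_non_decreasing x (encode s)); lia.
Qed.

Lemma nth_error_prefix (q : baire) k i :
  nth_error (prefix q k) i = if i <? k then Some (q i) else None.
Proof.
  unfold prefix; rewrite nth_error_map.
  destruct (Nat.ltb_spec i k).
  - now rewrite nth_error_nth' with (d := 0), seq_nth by now rewrite ?length_seq.
  - rewrite (proj2 (nth_error_None _ _)); [easy|now rewrite length_seq].
Qed.

Lemma tc_lookup F G : total_computable F -> total_computable G ->
  total_computable (fun p a => lookup (F p a) (G p a)).
Proof.
  intros HF HG.
  assert (Ht : total_computable (fun _ b => tl_code b)).
  { eapply tc_ext; [|apply tc_case with (F := fun _ b => b)
      (G := fun _ _ => 0) (H := fun _ b => pr2 (pr2 b))]; auto with tc.
    intros p [|b]; simpl; now rewrite ?pr2_pr. }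
  assert (Hh : total_computable (fun _ b => hd_code b)).
  { eapply tc_ext; [|apply tc_case with (F := fun _ b => b)
      (G := fun _ _ => 0) (H := fun _ b => S (pr1 (pr2 b)))]; auto with tc.
    intros p [|b]; simpl; now rewrite ?pr2_pr. }
  refine (tc_comp Hh _).
  eapply tc_ext; [|apply tc_rec with (F := F) (H := G)
    (G := fun _ b => tl_code (pr2 (pr2 b)))]; auto.
  - intros p a; simpl; induction (G p a) as [|n IH]; [easy|].
    cbn [nat_rect]; now rewrite IH, !pr2_pr.
  - apply (tc_comp Ht); auto with tc.
Qed.

Definition pair_oracle (p : baire) (s i : nat) : nat :=
  match (if Nat.even i then 0 else 1) with
  | 0 => S (p (Nat.div2 i))
  | S _ => lookup s (Nat.div2 i)
  end.

Definition curry_assoc (c : code) (p : baire) : baire :=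
  fun x => feval (pair_oracle p (pr2 x)) (pr2 x) c (pr1 x).

Lemma curry_assoc_computable c : exists e, forall p n,
  eval p e n (curry_assoc c p n).
Proof.
  assert (H : total_computable
    (fun p x => feval (pair_oracle p (pr1 x)) (pr1 x) c (pr2 x))).
  { apply tc_feval; unfold pair_oracle.
    apply tc_if; auto with tc.
    apply tc_lookup; auto with tc. }
  pose proof (tc_comp H (tc_pair (tc_pr2 tc_id) (tc_pr1 tc_id))) as [e He].
  exists e; intros p n; specialize (He p n); simpl in He.
  now rewrite pr1_pr, pr2_pr in He.
Qed.

Lemma curry_assoc_spec c p q r :
  (forall n, eval (bpair p q) c n (r n)) -> assoc_app (curry_assoc c p) q r.
Proof.
  intros H n; unfold curry_assoc.
  pose (v k := feval (pair_oracle p (encode (prefix q k))) (encode (prefix q k))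
                 c n).
  assert (O : forall k a x, pair_oracle p (encode (prefix q k)) a = S x ->
    x = bpair p q a).
  { intros k a x; unfold pair_oracle; rewrite bpair_if.
    destruct (Nat.even a); [congruence|].
    rewrite lookup_encode, nth_error_prefix.
    destruct (_ <? _); [congruence|easy]. }
  assert (S1 : forall k x, v k = S x -> x = r n).
  { intros k x E; apply (feval_sound (O k)) in E; eapply eval_fun; eauto. }
  destruct (feval_complete (H n)) as [k0 K].
  assert (E0 : v k0 <> 0).
  { unfold v; rewrite K; [easy| |].
    - pose proof (length_encode (prefix q k0)) as L.
      unfold prefix in L at 1; now rewrite length_map, length_seq in L.
    - intros i Li; unfold pair_oracle; rewrite bpair_if.
      destruct (Nat.even i); [easy|].
      rewrite lookup_encode, nth_error_prefix.
      destruct (Nat.ltb_spec (Nat.div2 i) k0) as [_|L]; [easy|].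
      pose proof (Nat.div2_decr i i ltac:(lia)); lia. }
  assert (M : exists k, v k <> 0 /\ forall j, j < k -> v j = 0).
  { assert (M : forall m, (exists k, v k <> 0 /\ forall j, j < k -> v j = 0)
                          \/ forall j, j < m -> v j = 0).
    { intros m; induction m as [|m [IH|IH]]; [right; lia|now left|].
      destruct (Nat.eq_dec (v m) 0) as [E|E]; [|left; eauto].
      right; intros j L; destruct (Nat.eq_dec j m) as [->|N]; auto.
      apply IH; lia. }
    destruct (M (S k0)) as [M'|M']; [exact M'|].
    exfalso; apply E0, M'; lia. }
  destruct M as (k & Ek & Lk).
  exists k; rewrite !pr1_pr, !pr2_pr; split.
  - change (v k = S (r n)).
    destruct (v k) as [|x] eqn:E; [easy|]; now rewrite (S1 _ _ E).
  - intros j L; rewrite pr1_pr, pr2_pr; now apply Lk.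
Qed.

Lemma tc_sub F G : total_computable F -> total_computable G ->
  total_computable (fun p a => F p a - G p a).
Proof.
  intros HF HG.
  eapply tc_ext; [|apply tc_rec with (F := F) (H := G)
    (G := fun _ b => pred (pr2 (pr2 b)))]; auto with tc.
  intros p a; simpl; induction (G p a) as [|n IH]; [simpl; lia|].
  cbn [nat_rect]; rewrite IH, !pr2_pr; lia.
Qed.

Lemma tc_prefix F G : total_computable F ->
  total_computable (fun p a => G p (pr2 a)) ->
  total_computable (fun p a => encode (prefix (G p) (F p a))).
Proof.
  intros HF HG.
  eapply tc_ext; [|apply tc_rec with (F := fun _ _ => 0) (H := F)
    (G := fun p b => S (pr (G p (pr2 (pr 0 (F p (pr1 b) - S (pr1 (pr2 b))))))
                           (pr2 (pr2 b))))].
  - intros p a; simpl; set (k := F p a) at 2.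
    assert (E : forall i, i <= k ->
      nat_rect (fun _ => nat) 0 (fun i v =>
        S (pr (G p (pr2 (pr 0 (F p (pr1 (pr a (pr i v)))
                               - S (pr1 (pr2 (pr a (pr i v))))))))
              (pr2 (pr2 (pr a (pr i v)))))) i
      = encode (map (G p) (seq (k - i) i))).
    { intros i; induction i as [|i IH]; intros L; [easy|].
      cbn [nat_rect]; rewrite IH by lia; simpl_pr; fold k.
      cbn [seq map encode]; replace (S (k - S i)) with (k - i) by lia; easy. }
    unfold prefix; fold k; rewrite (E k (le_n k)); now rewrite Nat.sub_diag.
  - auto with tc.
  - apply tc_succ, tc_pair; auto with tc.
    refine (tc_comp HG (tc_pair (tc_const 0) (tc_sub _ _))); auto with tc.
    apply tc_comp; auto with tc.
  - auto.
Qed.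

Lemma assoc_app_computable : exists e, forall c q r, assoc_app c q r ->
  forall n, eval (bpair c q) e n (r n).
Proof.
  pose (h (p : baire) (x : nat) :=
    p (2 * pr (pr1 x) (encode (prefix (fun i => p (S (2 * i))) (pr2 x))))).
  assert (Hh : total_computable h).
  { apply tc_query, tc_double, tc_pair; auto with tc.
    apply tc_prefix; auto with tc. }
  assert (Hz : total_computable (fun p x => match h p x with 0 => 1 | S _ => 0 end))
    by (apply tc_if; auto with tc).
  destruct Hz as [z Hz], (tc_pred Hh) as [o Ho], (tc_id) as [i Hi].
  exists (Comp o (Pair i (Mu z))); intros c q r H n.
  destruct (H n) as (k & Hk & Lk).
  assert (E : forall j, h (bpair c q) (pr n j) = c (pr n (encode (prefix q j)))).
  { intros j; unfold h; simpl_pr; rewrite bpair_l; do 2 f_equal.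
    f_equal; apply map_ext; intros a; apply bpair_r. }
  exists (pr n k); split.
  - exists n, k; split; [apply Hi|split; [|easy]].
    split.
    + specialize (Hz (bpair c q) (pr n k)); rewrite E, Hk in Hz; exact Hz.
    + intros m L; exists 0.
      specialize (Hz (bpair c q) (pr n m)); rewrite E, (Lk m L) in Hz; exact Hz.
  - specialize (Ho (bpair c q) (pr n k)); rewrite E, Hk in Ho; exact Ho.
Qed.

Theorem comp_product_spec (X Y Z W : rep_space) (f : mvfun X Y) (g : mvfun Z W) :
  is_comp_product f g (f ⋆ g).
Proof.
  destruct left_code as [cl Hl], right_code as [cr Hr].
  split.
  - pose (g0 := (fun i o => fst o = fst i /\ exists w, names (snd o) w /\ g (snd i) w)
      : mvfun (prod_space baire_space Z) (prod_space baire_space baire_space)).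
    pose (f0 := (fun i o => fst o = snd i /\ exists r x,
        assoc_app (fst i) (snd i) r /\ names r x /\ f x (snd o))
      : mvfun (prod_space baire_space baire_space) (prod_space baire_space Y)).
    exists (prod_space baire_space Z), (prod_space baire_space baire_space),
      (prod_space baire_space Y), f0, g0.
    assert (E : forall i o, (f ⋆ g) i o <-> mvcomp f0 g0 i o).
    { intros [c z] [q y]; unfold comp_product, mvcomp, f0, g0, mvdom; simpl; split.
      - intros (H & w & r & x & Hw & Hg & Ha & Hx & Hf); split.
        + intros [c' q'] [E (w' & Hw' & Hg')]; simpl in *; subst c'.
          destruct (H q' w' Hw' Hg') as (r' & x' & Ha' & Hx' & y' & Hf').
          exists (q', y'); simpl; split; [easy|eauto].
        + exists (c, q); simpl; split; [split; [easy|eauto]|].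
          split; [easy|eauto].
      - intros (H & [c' q'] & [E (w & Hw & Hg)] & E' & r & x & Ha & Hx & Hf);
          simpl in *; subst c' q'; split.
        + intros q' w' Hw' Hg'.
          destruct (H (c, q')) as ([q'' y''] & E'' & r' & x' & Ha' & Hx' & Hf');
            simpl in *; [split; [easy|eauto]|].
          exists r', x'; eauto.
        + exists w, r, x; auto. }
    split; [|split; [|split; apply le_W_of_iff; intros i o;
      [apply E|symmetry; apply E]]].
    + destruct assoc_app_computable as [ca Ha].
      destruct (join_codes (subst cl cr) cr) as [d Hd].
      apply le_W_pointwise; exists ca, d.
      intros p [c q] (p1 & p2 & -> & H1 & H2) [[q' y] [_ (r & x & Hc & Hx & Hf)]];
        simpl in *; subst p1 p2.
      exists r, x; split; [now apply Ha|split; [easy|split; [now exists y|]]].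
      intros s y' Hs Hy'; exists (bpair q s), (q, y'); split; [|split].
      * apply Hd; [|apply Hr].
        intros n; apply eval_subst with (q := bpair c q); [apply Hl|apply Hr].
      * exists q, s; auto.
      * split; [easy|]; exists r, x; auto.
    + destruct (join_codes (subst cl cl) cr) as [d Hd].
      apply le_W_pointwise; exists cr, d.
      intros p [c z] (p1 & p2 & -> & H1 & H2) [[c' q] [_ (w & Hw & Hg)]];
        simpl in *; subst p1.
      exists p2, z; split; [apply Hr|split; [easy|split; [now exists w|]]].
      intros s w' Hs Hw'; exists (bpair c s), (c, s); split; [|split].
      * apply Hd; [|apply Hr].
        intros n; apply eval_subst with (q := bpair c p2); apply Hl.
      * exists c, s; simpl; auto.
      * split; [easy|]; exists w'; auto.
  - intros A B C f1 g1 Hf Hg.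
    apply le_W_pointwise in Hf as (c1 & d1 & Hf).
    apply le_W_pointwise in Hg as (c2 & d2 & Hg).
    destruct (curry_assoc_computable (subst d2 c1)) as [e He].
    destruct (join_codes e c2) as [c Hc].
    (* from <p, <q, s>> to <d2 <p, q>, s> *)
    destruct (join_codes cl (subst cr cl)) as [u Hu].
    destruct (join_codes (subst u d2) (subst cr cr)) as [v Hv].
    apply le_W_pointwise; exists c, (subst v d1).
    intros p a Hp [b [Hdom (m & Hgm & Hfm)]].
    destruct (Hg p a Hp) as (p' & z & Hp' & Hz & Hgz & Kg); [now exists m|].
    assert (K : forall q w, names q w -> g z w -> exists t m' r x,
      (forall n, eval (bpair p q) d2 n (t n)) /\ names t m' /\ g1 a m'
      /\ assoc_app (curry_assoc (subst d2 c1) p) q r /\ names r x /\ mvdom f x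
      /\ forall s y, names s y -> f x y ->
           exists o b', (forall n, eval (bpair t s) d1 n (o n))
                        /\ names o b' /\ f1 m' b').
    { intros q w Hq Hw.
      destruct (Kg q w Hq Hw) as (t & m' & Ht & Hm' & Hgm').
      destruct (Hf t m' Hm' (Hdom m' Hgm')) as (r & x & Hr' & Hx & Hfx & Kf).
      exists t, m', r, x; repeat (split; [now auto|]).
      split; [|auto].
      apply curry_assoc_spec; intros n.
      apply eval_subst with (q := t); auto. }
    exists (bpair (curry_assoc (subst d2 c1) p) p'),
      (curry_assoc (subst d2 c1) p, z).
    split; [now apply Hc|split; [exists (curry_assoc (subst d2 c1) p), p'; simpl; auto|]].
    assert (D : forall q w, names q w -> g z w -> exists r x,
      assoc_app (curry_assoc (subst d2 c1) p) q r /\ names r x /\ mvdom f x).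
    { intros q w Hq Hw; destruct (K q w Hq Hw)
        as (t & m' & r & x & _ & _ & _ & Ha & Hx & Hfx & _).
      exists r, x; auto. }
    split.
    + destruct Hgz as [w Hw]; destruct (names_surj w) as [q Hq].
      destruct (D q w Hq Hw) as (r & x & Ha & Hx & y & Hy).
      exists (q, y); split; [exact D|]; exists w, r, x; auto.
    + intros qs [q y] (q' & s & -> & Hq & Hs) [_ (w & r & x & Hw & Hgw & Ha & Hx & Hy)];
        simpl in *; subst q'.
      destruct (K q w Hw Hgw) as (t & m' & r' & x' & Ht & Hm' & Hgm' & Ha' & Hx' & _ & Kf).
      pose proof (graph_fun (p0 := assoc_app (curry_assoc (subst d2 c1) p)) Ha' Ha); subst r'.
      pose proof (names_fun Hx' Hx); subst x'.
      destruct (Kf s y Hs Hy) as (o & b' & Ho & Hb' & Hfb).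
      exists o, b'; split; [|split; [easy|split; [easy|eauto]]].
      intros n; apply eval_subst with (q := bpair t s); [|apply Ho].
      apply Hv.
      * intros k; apply eval_subst with (q := bpair p q); [|apply Ht].
        apply Hu; [apply Hl|].
        intros j; apply eval_subst with (q := bpair q s); [apply Hr|apply Hl].
      * intros k; apply eval_subst with (q := bpair q s); apply Hr.
Qed.

(* Main.v *)
From Stdlib Require Import Arith Lia List Classical ClassicalEpsilon
  FunctionalExtensionality.
Require Import Defs.
Import ListNotations.

(** Given a tree [T], call a finite sequence [t] dead if no node of [T] of the
    same length lies pointwise below it, and ask for a Laver tree [L] that is
    homogeneous for the open set of those [g] which have a dead prefix. If [T] has
    a path [h], then [L] has a path dominating [h], because each node of [L] has
    arbitrarily large children ([laver_dominates]); no prefix of a sequence that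
    dominates a path is dead, so [L] falls on the side of the closed set. Hence
    for every path [g] of [L], in particular for the leftmost one, which is
    computable from [L], the part of [T] below [g] has nodes of every length.
    Finding a path of [T] has become a compact problem.

    The problem has to have a solution also when [T] is well founded and the part
    below [g] is finite. So this part is replaced by the tree [trunk T g], in which
    the conditions imposed by [T] are dropped at the dead levels. It always has
    nodes of every length, hence a path, by Koenig's lemma ([trunk_branch]), and
    its paths are paths of [T] when [T] is ill founded ([trunk_path_solves]).

    For the first reduction, the paths of [trunk T g] are represented by a closed
    set of binary sequences ([row_sums]), and a closed set computable from [g] and
    [T] is the set of paths of a binary tree computable from them
    ([closed_class_tree]); its name depends on the solution [L] through an
    associate. For the second, a path is not asked for but
    defined: the leftmost one that stays among the nodes with arbitrarily long
    extensions. Its values are arithmetical in [g] and [T] ([arith_leftmost]), and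
    arithmetical relations stay arithmetical when their oracle is replaced by a
    sequence computed from another one ([Sigma0_oracle]).

    Both reductions are defined only if the open set has a homogeneous Laver tree.
    When [T] has a path [f], the sequences above [f] form one; otherwise every [g]
    has a dead prefix and the full tree will do ([homogeneous_exists]). *)

Local Notation tc := total_computable.
Local Notation dec := decidable_rel.

#[local] Hint Resolve tc_id tc_const tc_succ tc_pr1 tc_pr2 tc_query tc_pair
  tc_pred tc_double tc_sub tc_lookup : tc.

(** * Computable functions and decidable relations *)

Lemma tc_add F G : tc F -> tc G -> tc (fun p a => F p a + G p a).
Proof.
  intros HF HG.
  eapply tc_ext; [|apply tc_rec with (F := F) (H := G)
    (G := fun _ b => S (pr2 (pr2 b)))]; auto with tc.
  intros p a; simpl; induction (G p a) as [|n IH]; [simpl; lia|].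
  cbn [nat_rect]; rewrite IH, !pr2_pr; lia.
Qed.

(** Sums serve for bounded quantification, for lengths of coded sequences and for
    the decoding of bounded sequences from binary ones. *)
Lemma tc_sum F (H : baire -> nat -> nat -> nat) :
  tc F -> tc (fun p b => H p (pr1 b) (pr2 b)) ->
  tc (fun p a => list_sum (map (H p a) (seq 0 (F p a)))).
Proof.
  intros HF HH.
  eapply tc_ext; [|apply tc_rec with (F := fun _ _ => 0) (H := F)
    (G := fun p b => pr2 (pr2 b) + H p (pr1 b) (pr1 (pr2 b)))]; auto with tc.
  - intros p a; simpl; induction (F p a) as [|n IH]; [easy|].
    cbn [nat_rect]; rewrite IH, seq_S, map_app, list_sum_app.
    simpl; simpl_pr; lia.
  - apply tc_add; auto with tc.
    eapply tc_ext; [|apply (tc_comp HH (tc_pair (tc_pr1 tc_id) (tc_pr1 (tc_pr2 tc_id))))].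
    intros p b; simpl; now simpl_pr.
Qed.

Lemma tc_map_seq F (H : baire -> nat -> nat -> nat) :
  tc F -> tc (fun p b => H p (pr1 b) (pr2 b)) ->
  tc (fun p a => encode (map (H p a) (seq 0 (F p a)))).
Proof.
  intros HF HH.
  eapply tc_ext; [|apply tc_rec with (F := fun _ _ => 0) (H := F)
    (G := fun p b => S (pr (H p (pr1 b) (F p (pr1 b) - S (pr1 (pr2 b))))
                           (pr2 (pr2 b))))]; auto with tc.
  - intros p a; simpl; set (k := F p a) at 2.
    (* The code is built from the right: after [i] steps it holds the last [i]
       entries. *)
    assert (E : forall i, i <= k ->
      nat_rect (fun _ => nat) 0 (fun i v =>
        S (pr (H p (pr1 (pr a (pr i v))) (F p (pr1 (pr a (pr i v)))
                               - S (pr1 (pr2 (pr a (pr i v))))))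
              (pr2 (pr2 (pr a (pr i v)))))) i
      = encode (map (H p a) (seq (k - i) i))).
    { intros i; induction i as [|i IH]; intros L; [easy|].
      cbn [nat_rect]; rewrite IH by lia; simpl_pr; fold k.
      cbn [seq map encode]; replace (S (k - S i)) with (k - i) by lia; easy. }
    fold k; rewrite (E k (le_n k)); now rewrite Nat.sub_diag.
  - apply tc_succ, tc_pair; auto with tc.
    eapply tc_ext; [|apply (tc_comp HH (tc_pair (tc_pr1 tc_id)
      (tc_sub (tc_comp HF (tc_pr1 tc_id)) (tc_succ (tc_pr1 (tc_pr2 tc_id))))))].
    intros p b; simpl; now simpl_pr.
Qed.

Lemma dec_iff R R' : (forall p a, R p a <-> R' p a) -> dec R -> dec R'.
Proof.
  intros E [c Hc]; exists c; intros p a.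
  destruct (Hc p a) as [[H1 H2]|[H1 H2]]; rewrite E in H1; auto.
Qed.

Lemma dec_subst R F : dec R -> tc F -> dec (fun p a => R p (F p a)).
Proof.
  intros [c Hc] [d Hd]; exists (Comp c d); intros p a; simpl.
  destruct (Hc p (F p a)) as [[H1 H2]|[H1 H2]]; [left|right]; eauto.
Qed.

Lemma dec_zero F : tc F -> dec (fun p a => F p a = 0).
Proof.
  intros HF.
  destruct (tc_if HF (tc_const 1) (tc_const 0)) as [c Hc].
  exists c; intros p a; specialize (Hc p a); destruct (F p a); auto.
Qed.

(** The indicator is stated through its zeros, so that sums of indicators
    express bounded quantifiers. *)
Lemma dec_indicator R : dec R ->
  exists F, tc F /\ forall p a, F p a = 0 <-> R p a.
Proof.
  intros [c Hc].
  exists (fun p a => if excluded_middle_informative (R p a) then 0 else 1); split.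
  - eapply tc_ext; [|apply tc_if with (G := fun _ _ => 1) (H := fun _ _ => 0)
      (F := fun p a => if excluded_middle_informative (R p a) then 1 else 0)];
      auto with tc.
    + intros p a; simpl; now destruct excluded_middle_informative.
    + exists c; intros p a.
      destruct excluded_middle_informative; destruct (Hc p a) as [[]|[]]; easy.
  - intros p a; now destruct excluded_middle_informative.
Qed.

Lemma dec_not R : dec R -> dec (fun p a => ~ R p a).
Proof.
  intros [c Hc].
  destruct (dec_indicator R) as (F & HF & E); [now exists c|].
  eapply dec_iff; [|apply dec_zero with (F := fun p a => 1 - F p a)];
    auto with tc.
  intros p a; cbn beta; rewrite <- E; lia.
Qed.

Lemma dec_and R Q : dec R -> dec Q -> dec (fun p a => R p a /\ Q p a).
Proof.
  intros HR HQ.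
  destruct (dec_indicator _ HR) as (F & HF & EF), (dec_indicator _ HQ) as (G & HG & EG).
  eapply dec_iff; [|apply dec_zero, (tc_add _ _ HF HG)].
  intros p a; simpl; rewrite <- EF, <- EG; lia.
Qed.

Lemma dec_imp R Q : dec R -> dec Q -> dec (fun p a => R p a -> Q p a).
Proof.
  intros HR HQ.
  eapply dec_iff; [|apply dec_not, (dec_and _ _ HR (dec_not _ HQ))].
  intros p a; simpl; tauto.
Qed.

Lemma dec_or R Q : dec R -> dec Q -> dec (fun p a => R p a \/ Q p a).
Proof.
  intros HR HQ.
  eapply dec_iff; [|apply (dec_imp _ _ (dec_not _ HR) HQ)].
  intros p a; simpl; tauto.
Qed.

Lemma dec_le F G : tc F -> tc G -> dec (fun p a => F p a <= G p a).
Proof.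
  intros HF HG; eapply dec_iff; [|apply dec_zero, (tc_sub HF HG)].
  intros p a; simpl; lia.
Qed.

Lemma dec_eq F G : tc F -> tc G -> dec (fun p a => F p a = G p a).
Proof.
  intros HF HG; eapply dec_iff; [|apply (dec_and _ _ (dec_le _ _ HF HG) (dec_le _ _ HG HF))].
  intros p a; simpl; lia.
Qed.

Lemma dec_all F (R : baire -> nat -> nat -> Prop) :
  tc F -> dec (fun p b => R p (pr1 b) (pr2 b)) ->
  dec (fun p a => forall i, i < F p a -> R p a i).
Proof.
  intros HF HR.
  destruct (dec_indicator _ HR) as (G & HG & E).
  eapply dec_iff; [|apply dec_zero, (tc_sum F (fun p a i => G p (pr a i)) HF)].
  - intros p a; cbn beta.
    assert (K : forall i, G p (pr a i) = 0 <-> R p a i).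
    { intros i; rewrite E; now simpl_pr. }
    induction (F p a) as [|n IH]; [simpl; split; [lia|easy]|].
    rewrite seq_S, map_app, list_sum_app; simpl.
    split.
    + intros H i L; destruct (Nat.eq_dec i n) as [->|N]; [apply K; lia|].
      apply IH; lia.
    + intros H; rewrite (proj2 IH), (proj2 (K n)); auto.
  - eapply tc_ext; [|exact HG]; intros p b; simpl; now rewrite pr_eta.
Qed.

Lemma dec_ex F (R : baire -> nat -> nat -> Prop) :
  tc F -> dec (fun p b => R p (pr1 b) (pr2 b)) ->
  dec (fun p a => exists i, i < F p a /\ R p a i).
Proof.
  intros HF HR.
  eapply dec_iff; [|apply dec_not, (dec_all F (fun p a i => ~ R p a i) HF),
    dec_not, HR].
  intros p a; simpl; split.
  - intros H; apply NNPP; intros N; apply H; intros i L Hi; apply N; eauto.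
  - intros (i & L & Hi) H; exact (H i L Hi).
Qed.

(** * Finite sequences as numbers *)

(** The length of a sequence is bounded by its code, so counting the positions
    below the code finds it. *)
Definition code_length (a : nat) : nat :=
  list_sum (map (fun i => match lookup a i with 0 => 0 | S _ => 1 end) (seq 0 a)).

Definition decode (a : nat) : list nat :=
  map (fun i => pred (lookup a i)) (seq 0 (code_length a)).

Lemma code_length_encode s : code_length (encode s) = length s.
Proof.
  unfold code_length.
  assert (K : forall n, list_sum (map (fun i =>
      match lookup (encode s) i with 0 => 0 | S _ => 1 end) (seq 0 n))
    = Nat.min n (length s)).
  { intros n; induction n as [|n IH]; [easy|].
    rewrite seq_S, map_app, list_sum_app, IH; cbn [map list_sum fold_right Nat.add].
    rewrite lookup_encode.
    destruct (nth_error s n) eqn:E.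
    - assert (n < length s) by (apply nth_error_Some; congruence); lia.
    - apply nth_error_None in E; lia. }
  rewrite K; pose proof (length_encode s); lia.
Qed.

Lemma decode_encode s : decode (encode s) = s.
Proof.
  unfold decode; rewrite code_length_encode.
  apply nth_error_ext; intros i.
  rewrite nth_error_map.
  destruct (Nat.lt_ge_cases i (length s)) as [L|L].
  - rewrite nth_error_nth' with (d := 0), seq_nth by now rewrite ?length_seq.
    simpl; rewrite lookup_encode.
    destruct (nth_error s i) eqn:E; [easy|].
    apply nth_error_None in E; lia.
  - rewrite (proj2 (nth_error_None s i) L), (proj2 (nth_error_None _ _)); [easy|].
    now rewrite length_seq.
Qed.

Lemma pr_mono a b a' b' : a <= a' -> b <= b' -> pr a b <= pr a' b'.
Proof.
  intros H1 H2; unfold pr; pose proof (Cantor.to_nat_spec a b) as E.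
  pose proof (Cantor.to_nat_spec a' b') as E'.
  assert ((a + b) * S (a + b) <= (a' + b') * S (a' + b'))
    by (apply Nat.mul_le_mono; lia).
  lia.
Qed.

Lemma encode_decode a : encode (decode a) = a.
Proof.
  assert (K : exists s, encode s = a).
  { induction a as [a IH] using lt_wf_ind.
    destruct a as [|a]; [now exists []|].
    destruct (IH (pr2 a)) as [s Hs].
    { pose proof (Cantor.to_nat_non_decreasing (pr1 a) (pr2 a)) as H.
      fold (pr (pr1 a) (pr2 a)) in H; rewrite pr_eta in H; lia. }
    exists (pr1 a :: s); simpl; now rewrite Hs, pr_eta. }
  destruct K as [s <-]; now rewrite decode_encode.
Qed.

Lemma length_decode a : length (decode a) = code_length a.
Proof. now rewrite <- code_length_encode, encode_decode. Qed.

Lemma lookup_decode a i :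
  lookup a i = match nth_error (decode a) i with None => 0 | Some x => S x end.
Proof. now rewrite <- lookup_encode, encode_decode. Qed.

Lemma tc_length F : tc F -> tc (fun p a => length (decode (F p a))).
Proof.
  intros HF; eapply tc_ext; [intros p a; symmetry; apply length_decode|].
  unfold code_length; apply (tc_sum F (fun p a i => match lookup (F p a) i with
    0 => 0 | S _ => 1 end) HF).
  apply tc_if; auto with tc.
  apply tc_lookup; auto with tc; apply (tc_comp HF); auto with tc.
Qed.

Lemma tc_nth F G : tc F -> tc G -> tc (fun p a => nth (G p a) (decode (F p a)) 0).
Proof.
  intros HF HG.
  eapply tc_ext; [|apply (tc_pred (tc_lookup HF HG))].
  intros p a; simpl; rewrite lookup_decode.
  destruct (nth_error _ _) eqn:E.
  - symmetry; now apply nth_error_nth.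
  - apply nth_error_None in E; now rewrite nth_overflow.
Qed.

Lemma firstn_map_seq (s : list nat) k :
  firstn k s = map (fun i => nth i s 0) (seq 0 (Nat.min k (length s))).
Proof.
  apply nth_ext with (d := 0) (d' := 0);
    rewrite length_firstn; [now rewrite length_map, length_seq|].
  intros i L; rewrite nth_firstn.
  rewrite nth_indep with (d' := nth 0 s 0) (n := i) (l := map _ _)
    by (rewrite length_map, length_seq; lia).
  rewrite (map_nth (fun i => nth i s 0)), seq_nth by lia.
  destruct (Nat.ltb_spec i k); [easy|lia].
Qed.

Lemma tc_firstn F K : tc F -> tc K ->
  tc (fun p a => encode (firstn (K p a) (decode (F p a)))).
Proof.
  intros HF HK.
  eapply tc_ext; [intros p a; symmetry; rewrite firstn_map_seq; reflexivity|].
  apply (tc_map_seq (fun p a => Nat.min (K p a) (length (decode (F p a))))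
    (fun p a i => nth i (decode (F p a)) 0)).
  - eapply tc_ext; [|apply (tc_sub HK (tc_sub HK (tc_length _ HF)))].
    intros p a; simpl; lia.
  - apply tc_nth; auto with tc; apply (tc_comp HF); auto with tc.
Qed.

Lemma tc_snoc F G : tc F -> tc G ->
  tc (fun p a => encode (decode (F p a) ++ [G p a])).
Proof.
  intros HF HG.
  eapply tc_ext; [|apply (tc_map_seq (fun p a => S (length (decode (F p a))))
    (fun p a i => match lookup (F p a) i with 0 => G p a
                  | S _ => pred (lookup (F p a) i) end))].
  - intros p a; cbn beta; f_equal.
    rewrite seq_S, map_app; f_equal.
    + rewrite <- (firstn_all (decode (F p a))) at 2.
      rewrite firstn_map_seq, Nat.min_id.
      apply map_ext_in; intros i Hi; apply in_seq in Hi.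
      rewrite lookup_decode, nth_error_nth' with (d := 0) by lia; easy.
    + simpl; now rewrite lookup_decode, (proj2 (nth_error_None _ _)).
  - now apply tc_succ, tc_length.
  - assert (tc (fun p b => F p (pr1 b))) by (apply (tc_comp HF); auto with tc).
    apply tc_if; auto with tc; apply (tc_comp HG); auto with tc.
Qed.

Lemma dec_list_eq F G : tc (fun p a => encode (F p a)) ->
  tc (fun p a => encode (G p a)) -> dec (fun p a => F p a = G p a :> list nat).
Proof.
  intros HF HG; eapply dec_iff; [|apply (dec_eq _ _ HF HG)].
  intros p a; simpl; split; [apply encode_inj|congruence].
Qed.

(** * The bounded subtree *)

(** When [t] is a prefix of [g], the tree has no node of this length below [g]. *)
Definition dead (T : list nat -> Prop) (t : list nat) : Prop :=
  forall s, Forall2 le s t -> ~ T s.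

(** The tree cut down to the sequences below [g]. Dead levels impose no condition,
    which keeps the trunk infinite when the part of [T] below [g] is finite. *)
Definition trunk (T : list nat -> Prop) (g : baire) (s : list nat) : Prop :=
  Forall2 le s (prefix g (length s))
  /\ forall k, k <= length s -> T (firstn k s) \/ dead T (prefix g k).

Lemma length_prefix g n : length (prefix g n) = n.
Proof. unfold prefix; now rewrite length_map, length_seq. Qed.

Lemma prefix_S g n : prefix g (S n) = prefix g n ++ [g n].
Proof. unfold prefix; now rewrite seq_S, map_app. Qed.

Lemma firstn_prefix g k n : k <= n -> firstn k (prefix g n) = prefix g k.
Proof.
  intros L; apply nth_error_ext; intros i.
  rewrite nth_error_firstn, !nth_error_prefix.
  destruct (Nat.ltb_spec i k), (Nat.ltb_spec i n); easy || lia.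
Qed.

Lemma nth_prefix g i n : i < n -> nth i (prefix g n) 0 = g i.
Proof.
  intros L; unfold prefix.
  rewrite nth_indep with (d' := g 0) by (rewrite length_map, length_seq; lia).
  now rewrite map_nth, seq_nth.
Qed.

Lemma firstn_S_nth (s : list nat) i : i < length s ->
  firstn (S i) s = firstn i s ++ [nth i s 0].
Proof.
  revert i; induction s as [|x s IH]; intros [|i] L; simpl in *; try easy; try lia.
  now rewrite <- IH by lia.
Qed.

Lemma Forall2_le_nth s t : Forall2 le s t <->
  length s = length t /\ forall i, i < length s -> nth i s 0 <= nth i t 0.
Proof.
  revert t; induction s as [|x s IH]; intros [|y t]; simpl.
  - split; [split; [easy|lia]|constructor].
  - split; [intros H; inversion H|easy].
  - split; [intros H; inversion H|easy].
  - rewrite Forall2_cons_iff, IH; split.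
    + intros (L & E & K); split; [lia|]; intros [|i] Li; [easy|apply K; lia].
    + intros [E K]; split; [apply (K 0); lia|split; [lia|]].
      intros i L; apply (K (S i)); lia.
Qed.

Lemma Forall2_le_prefix g s n : Forall2 le s (prefix g n) <->
  length s = n /\ forall i, i < n -> nth i s 0 <= g i.
Proof.
  rewrite Forall2_le_nth, length_prefix; split; intros [<- K]; split; auto;
    intros i L; specialize (K i L); now rewrite nth_prefix in *.
Qed.

Lemma encode_le s t : Forall2 le s t -> encode s <= encode t.
Proof.
  induction 1; simpl; [easy|]; apply le_n_S, pr_mono; auto.
Qed.

Lemma dec_Forall2_le F G : tc F -> tc G ->
  dec (fun p a => Forall2 le (decode (F p a)) (decode (G p a))).
Proof.
  intros HF HG.
  eapply dec_iff; [intros p a; symmetry; apply Forall2_le_nth|].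
  apply dec_and; [apply dec_eq; now apply tc_length|].
  apply (dec_all (fun p a => length (decode (F p a)))
    (fun p a i => nth i (decode (F p a)) 0 <= nth i (decode (G p a)) 0));
    [now apply tc_length|].
  apply dec_le; apply tc_nth; auto with tc;
    [apply (tc_comp HF)|apply (tc_comp HG)]; auto with tc.
Qed.

(** Codes are monotone in the entries, so only the codes up to that of the given
    sequence have to be inspected. *)
Lemma dec_dead (T : baire -> list nat -> Prop) F :
  dec (fun p a => T p (decode a)) -> tc F ->
  dec (fun p a => dead (T p) (decode (F p a))).
Proof.
  intros HT HF.
  eapply dec_iff; [|apply (dec_all (fun p a => S (F p a)) (fun p a b =>
    Forall2 le (decode b) (decode (F p a)) -> ~ T p (decode b)))].
  - intros p a; simpl; split.
    + intros H s Hs; rewrite <- (decode_encode s).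
      apply H; rewrite ?decode_encode; auto.
      rewrite <- (encode_decode (F p a)); apply le_n_S, encode_le; auto.
    + intros H b _; apply H.
  - auto with tc.
  - apply dec_imp; [apply dec_Forall2_le|apply dec_not, (dec_subst _ _ HT)];
      auto with tc.
    apply (tc_comp HF); auto with tc.
Qed.

Lemma tc_prefix_at (G : baire -> baire) F : tc G -> tc F ->
  tc (fun p a => encode (prefix (G p) (F p a))).
Proof.
  intros HG HF; apply (tc_map_seq F (fun p _ i => G p i) HF).
  apply (tc_comp HG); auto with tc.
Qed.

Lemma dec_trunk (T : baire -> list nat -> Prop) (G : baire -> baire) F :
  dec (fun p a => T p (decode a)) -> tc G -> tc F ->
  dec (fun p a => trunk (T p) (G p) (decode (F p a))).
Proof.
  intros HT HG HF.
  assert (HL := tc_length _ HF).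
  apply dec_and.
  - eapply dec_iff; [|apply dec_Forall2_le; [apply HF|apply (tc_prefix_at _ _ HG HL)]].
    intros p a; simpl; now rewrite decode_encode.
  - eapply dec_iff; [|apply (dec_all (fun p a => S (length (decode (F p a))))
      (fun p a k => T p (decode (encode (firstn k (decode (F p a)))))
        \/ dead (T p) (decode (encode (prefix (G p) k)))))].
    + intros p a; cbn beta; split; intros H k L; specialize (H k ltac:(lia));
        now rewrite !decode_encode in *.
    + auto with tc.
    + apply dec_or; [apply (dec_subst _ _ HT)|apply dec_dead; auto].
      * apply tc_firstn; auto with tc; apply (tc_comp HF); auto with tc.
      * apply tc_prefix_at; auto with tc.
Qed.

Lemma trunk_firstn T g s k : trunk T g s -> trunk T g (firstn k s).
Proof.
  intros [B H]; apply Forall2_le_prefix in B as [_ B].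
  pose proof (length_firstn k s) as E.
  split.
  - apply Forall2_le_prefix; split; [easy|]; intros i L; rewrite E in L.
    rewrite nth_firstn; destruct (Nat.ltb_spec i k); [apply B; lia|lia].
  - intros j L; rewrite E in L; rewrite firstn_firstn.
    replace (Nat.min j k) with j by lia; apply H; lia.
Qed.

(** A node of the tree below [g] is a node of the trunk, because the tree is closed
    under prefixes. At a dead level there is no condition, so a zero can be
    appended to a shorter node. *)
Lemma trunk_unbounded T g n : is_tree T -> exists s, length s = n /\ trunk T g s.
Proof.
  intros HT.
  assert (K : forall n, ~ dead T (prefix g n) -> exists s, length s = n /\ trunk T g s).
  { clear n; intros n N; apply NNPP; intros N'; apply N; intros s B Ts; apply N'.
    exists s; pose proof B as B'; apply Forall2_le_prefix in B' as [E _].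
    split; [easy|split; [now rewrite E|]].
    intros k _; left; apply (HT _ (skipn k s)); now rewrite firstn_skipn. }
  induction n as [|n (s & E & B & H)].
  - exists []; split; [easy|split; [constructor|]].
    intros k L; simpl in L; replace k with 0 by lia; simpl.
    destruct (classic (T [])) as [Y|N]; [now left|right].
    intros s B; inversion B; now subst.
  - destruct (classic (dead T (prefix g (S n)))) as [D|D]; [|now apply K].
    exists (s ++ [0]); rewrite length_app, E; simpl; split; [lia|split].
    + rewrite length_app, E, Nat.add_1_r, prefix_S; rewrite E in B.
      apply Forall2_app; auto using le_0_n.
    + intros k L; rewrite length_app, E in L; simpl in L.
      destruct (Nat.eq_dec k (S n)) as [->|N]; [now right|].
      rewrite firstn_app, E; replace (k - n) with 0 by lia.
      simpl; rewrite app_nil_r; apply H; lia.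
Qed.

Lemma path_trunk T g f : path (trunk T g) f ->
  (forall n, ~ dead T (prefix g n)) -> path T f.
Proof.
  intros H N n; destruct (H n) as [_ K].
  destruct (K n) as [Y|Y]; [now rewrite length_prefix|..].
  - now rewrite firstn_prefix in Y.
  - now apply N in Y.
Qed.

Lemma path_trunk_le T g f n : path (trunk T g) f -> f n <= g n.
Proof.
  intros H; destruct (H (S n)) as [B _].
  apply Forall2_le_prefix in B as [_ B]; rewrite length_prefix in B.
  specialize (B n (Nat.lt_succ_diag_r n)); now rewrite nth_prefix in B by lia.
Qed.

(** * Leftmost branches *)

Definition least_child (E : list nat -> Prop) (s : list nat) (x : nat) : Prop :=
  E (s ++ [x]) /\ forall y, y < x -> ~ E (s ++ [y]).

Definition leftmost (E : list nat -> Prop) (f : baire) : Prop :=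
  forall n, least_child E (prefix f n) (f n).

Lemma branch_exists (E : list nat -> Prop) (P : list nat -> nat -> Prop) :
  E [] -> (forall s, E s -> exists x, P s x) ->
  (forall s x, P s x -> E (s ++ [x])) ->
  exists f, path E f /\ forall n, P (prefix f n) (f n).
Proof.
  intros H0 HS HE.
  pose (next s := epsilon (inhabits 0) (P s)).
  pose (node := nat_rect (fun _ => list nat) [] (fun _ s => s ++ [next s])).
  exists (fun n => next (node n)).
  assert (N : forall n, prefix (fun n => next (node n)) n = node n).
  { intros n; induction n as [|n IH]; [easy|]; now rewrite prefix_S, IH. }
  assert (K : forall n, E (node n)).
  { intros n; induction n as [|n IH]; [easy|].
    apply HE, epsilon_spec, HS, IH. }
  split; intros n; rewrite N; [apply K|apply epsilon_spec, HS, K].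
Qed.

Lemma least_exists (P : nat -> Prop) :
  (exists x, P x) -> exists x, P x /\ forall y, y < x -> ~ P y.
Proof.
  intros [x Hx]; induction x as [x IH] using lt_wf_ind.
  destruct (classic (exists y, y < x /\ P y)) as [(y & L & Hy)|N]; [eauto|].
  exists x; split; [easy|]; intros y L Hy; apply N; eauto.
Qed.

(** Classically, the least children form a branch which depends on the tree only;
    this uniqueness is what makes the branch computable or definable. *)
Lemma leftmost_exists (E : list nat -> Prop) :
  E [] -> (forall s, E s -> exists x, E (s ++ [x])) ->
  exists f, path E f /\ leftmost E f.
Proof.
  intros H0 HS; apply (branch_exists E (least_child E)); auto.
  - intros s Hs; apply (least_exists (fun x => E (s ++ [x]))); auto.
  - now intros s x [H _].
Qed.

Lemma least_child_unique E s x y : least_child E s x -> least_child E s y -> x = y.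
Proof.
  intros [H K] [H' K']; destruct (Nat.lt_trichotomy x y) as [L|[L|L]]; auto.
  - now apply K' in L.
  - now apply K in L.
Qed.

(** A finite sequence that follows least children is an initial segment of the
    leftmost branch, so the values of that branch are definable by quantifying
    over finite sequences. *)
Lemma leftmost_value E f n m : leftmost E f ->
  (exists u, n < length u /\ nth n u 0 = m
     /\ forall i, i < length u -> least_child E (firstn i u) (nth i u 0))
  <-> f n = m.
Proof.
  intros Hf; split.
  - intros (u & L & <- & H).
    assert (K : forall i, i <= length u -> firstn i u = prefix f i).
    { intros i; induction i as [|i IH]; intros Li; [easy|].
      specialize (H i ltac:(lia)); rewrite firstn_S_nth, prefix_S, IH in * by lia.
      do 2 f_equal; eapply least_child_unique; [exact H|apply Hf]. }
    specialize (H n L); rewrite K in H by lia.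
    eapply least_child_unique; [apply Hf|exact H].
  - intros <-; exists (prefix f (S n)); rewrite length_prefix.
    split; [lia|split; [apply nth_prefix; lia|]].
    intros i L; rewrite firstn_prefix, nth_prefix by lia; apply Hf.
Qed.

(** With an oracle for the tree, the least child of a node is found by
    unbounded search as soon as the node has one. *)
Lemma leftmost_code : exists e, forall (l : baire) (L : list nat -> Prop) f,
  (forall s, L s -> l (encode s) = 1) -> (forall s, ~ L s -> l (encode s) = 0) ->
  leftmost L f -> forall n, eval l e n (f n).
Proof.
  assert (Hs : tc (fun p a => encode (decode (pr1 a) ++ [pr2 a])))
    by (apply tc_snoc; auto with tc).
  destruct Hs as [snoc Hs].
  assert (Ht : tc (fun p a => 1 - p (encode (decode (pr1 a) ++ [pr2 a]))))
    by (apply tc_sub; auto with tc; apply tc_query, tc_snoc; auto with tc).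
  destruct Ht as [test Ht], (tc_pr2 (tc_pr2 tc_id)) as [s2 Hs2], tc_id as [i Hi].
  (* [next] works inside the recursion, on triples of the parameter, the step and
     the current node. *)
  pose (next := Comp (Comp snoc (Pair i (Mu test))) s2).
  exists (Comp (Mu test) (Comp (Prec Zero next) (Pair Zero i))).
  intros l L f H1 H0 Hf n.
  assert (M : forall n, eval l (Mu test) (encode (prefix f n)) (f n)).
  { intros k; destruct (Hf k) as [K K']; split.
    - specialize (Ht l (pr (encode (prefix f k)) (f k))).
      revert Ht; simpl_pr; rewrite decode_encode, H1; auto.
    - intros m Lm; exists 0.
      specialize (Ht l (pr (encode (prefix f k)) m)).
      revert Ht; simpl_pr; rewrite decode_encode, H0; auto. }
  exists (encode (prefix f n)); split; [|apply M].
  exists (pr 0 n); split; [exists 0, n; split; [easy|split; [apply Hi|easy]]|].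
  exists (fun k => encode (prefix f k)); simpl_pr; split; [easy|split; [|easy]].
  intros k _; exists (encode (prefix f k)); split.
  - specialize (Hs2 l (pr 0 (pr k (encode (prefix f k))))).
    now rewrite !pr2_pr in Hs2.
  - exists (pr (encode (prefix f k)) (f k)); split.
    + exists (encode (prefix f k)), (f k); split; [apply Hi|split; [apply M|easy]].
    + specialize (Hs l (pr (encode (prefix f k)) (f k))).
      rewrite pr1_pr, pr2_pr, decode_encode, <- prefix_S in Hs; exact Hs.
Qed.

(** * Koenig's lemma for bounded trees *)

(** On a bounded tree these are the nodes that lie on a path. Speaking of heights
    instead of paths keeps the definition arithmetical. *)
Definition extendible (U : list nat -> Prop) (s : list nat) : Prop :=
  forall m, exists t, m <= length t /\ U t /\ firstn (length s) t = s.

(** If no bounded child were extendible, the finitely many bounds on the heights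
    above them would bound the height above the node itself. *)
Lemma extendible_child (U : list nat -> Prop) (g : baire) s :
  (forall t i, U t -> i < length t -> nth i t 0 <= g i) ->
  extendible U s -> exists x, extendible U (s ++ [x]).
Proof.
  intros HU Hs; apply NNPP; intros N.
  assert (K : forall b, exists M, forall x t, x < b -> M <= length t -> U t ->
    firstn (length (s ++ [x])) t <> s ++ [x]).
  { intros b; induction b as [|b [M HM]]; [exists 0; intros; lia|].
    destruct (classic (exists m, forall t, m <= length t -> U t ->
      firstn (length (s ++ [b])) t <> s ++ [b])) as [[m Hm]|N'].
    - exists (M + m); intros x t Lx Lt Ut.
      destruct (Nat.eq_dec x b) as [->|Nx]; [apply Hm|apply HM]; auto; lia.
    - exfalso; apply N; exists b; intros m; apply NNPP; intros N2; apply N'.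
      exists m; intros t Lt Ut E; apply N2; eauto. }
  destruct (K (S (g (length s)))) as [M HM].
  destruct (Hs (M + S (length s))) as (t & Lt & Ut & E).
  apply (HM (nth (length s) t 0) t); [|lia|easy|].
  - apply le_n_S, HU; auto; lia.
  - rewrite length_app, Nat.add_1_r.
    rewrite firstn_S_nth, E by lia; easy.
Qed.

(** The path is the leftmost one through extendible nodes, so that the same
    existence proof serves the definability of the path. *)
Lemma trunk_branch T g : is_tree T -> exists f,
  path (trunk T g) f /\ leftmost (extendible (trunk T g)) f.
Proof.
  intros HT.
  destruct (leftmost_exists (extendible (trunk T g))) as (f & P & H).
  - intros m; destruct (trunk_unbounded T g m HT) as (s & <- & Hs).
    exists s; auto.
  - intros s; apply extendible_child with (g := g); intros t i [B _] L.
    apply Forall2_le_prefix in B as [_ B]; auto.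
  - exists f; split; [|easy]; intros n.
    destruct (P n n) as (t & _ & Ht & <-); now apply trunk_firstn.
Qed.

(** * Arithmetical relations *)

Definition arith (R : baire -> nat -> Prop) : Prop := exists k, Sigma0 k R.

Lemma Sigma0_iff k R R' : (forall p a, R p a <-> R' p a) -> Sigma0 k R -> Sigma0 k R'.
Proof.
  intros E; destruct k as [|k]; simpl; [now apply dec_iff|].
  intros (Q & HQ & H); exists Q; split; [easy|]; intros p a; now rewrite <- E.
Qed.

Lemma Sigma0_arg k R F : Sigma0 k R -> tc F -> Sigma0 k (fun p a => R p (F p a)).
Proof.
  revert R F; induction k as [|k IH]; simpl; intros R F.
  - apply dec_subst.
  - intros (Q & HQ & H) HF.
    exists (fun p b => Q p (pr (F p (pr1 b)) (pr2 b))); split.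
    + apply IH; auto with tc; apply tc_pair; auto with tc.
      apply (tc_comp HF); auto with tc.
    + intros p a; rewrite H; split; intros [m Hm]; exists m; revert Hm; now simpl_pr.
Qed.

(** A decidable relation is an existential one with a dummy quantifier; from there
    on the inclusion passes through the complements. *)
Lemma Sigma0_S k R : Sigma0 k R -> Sigma0 (S k) R.
Proof.
  revert R; induction k as [|k IH]; intros R.
  - intros HR; exists (fun p b => ~ R p (pr1 b)); split.
    + apply dec_not, (dec_subst _ _ HR); auto with tc.
    + intros p a; split.
      * intros H; exists 0; now rewrite pr1_pr.
      * intros [m Hm]; rewrite pr1_pr in Hm; tauto.
  - intros (Q & HQ & H); exists Q; split; auto.
Qed.

Lemma Sigma0_add k j R : Sigma0 k R -> Sigma0 (j + k) R.
Proof. intros H; induction j as [|j IH]; [easy|]; now apply Sigma0_S. Qed.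

(** Conjunction at one level needs disjunction at the level below, and conversely,
    because each level negates the matrix. *)
Lemma Sigma0_and_or k : forall R Q, Sigma0 k R -> Sigma0 k Q ->
  Sigma0 k (fun p a => R p a /\ Q p a) /\ Sigma0 k (fun p a => R p a \/ Q p a).
Proof.
  induction k as [|k IH]; intros R Q.
  - split; [now apply dec_and|now apply dec_or].
  - intros (R0 & HR & ER) (Q0 & HQ & EQ).
    assert (HR1 : Sigma0 k (fun p b => R0 p (pr (pr1 b) (pr1 (pr2 b)))))
      by (apply (Sigma0_arg k _ _ HR); auto with tc).
    assert (HQ1 : Sigma0 k (fun p b => Q0 p (pr (pr1 b) (pr2 (pr2 b)))))
      by (apply (Sigma0_arg k _ _ HQ); auto with tc).
    destruct (IH _ _ HR1 HQ1) as [HA HO]; split.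
    + eexists; split; [exact HO|]; intros p a; rewrite ER, EQ; split.
      * intros [[m Hm] [n Hn]]; exists (pr m n); simpl_pr; tauto.
      * intros [m Hm]; revert Hm; simpl_pr; intros Hm.
        split; [exists (pr1 m)|exists (pr2 m)]; tauto.
    + eexists; split; [exact HA|]; intros p a; rewrite ER, EQ; split.
      * intros [[m Hm]|[m Hm]]; exists (pr m m); simpl_pr; tauto.
      * intros [m Hm]; revert Hm; simpl_pr; intros Hm.
        apply not_and_or in Hm as [Hm|Hm]; [left|right]; eauto.
Qed.

Lemma arith_dec R : dec R -> arith R.
Proof. now exists 0. Qed.

Lemma arith_iff R R' : (forall p a, R p a <-> R' p a) -> arith R -> arith R'.
Proof. intros E [k H]; exists k; now apply (Sigma0_iff k R). Qed.

Lemma arith_arg R F : arith R -> tc F -> arith (fun p a => R p (F p a)).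
Proof. intros [k H] HF; exists k; now apply Sigma0_arg. Qed.

Lemma arith_not R : arith R -> arith (fun p a => ~ R p a).
Proof.
  intros [k H]; exists (S k), (fun p b => R p (pr1 b)); split.
  - apply Sigma0_arg; auto with tc.
  - intros p a; split.
    + intros N; exists 0; now rewrite pr1_pr.
    + intros [m Hm]; now rewrite pr1_pr in Hm.
Qed.

Lemma arith_and R Q : arith R -> arith Q -> arith (fun p a => R p a /\ Q p a).
Proof.
  intros [k HR] [j HQ]; exists (j + k); apply Sigma0_and_or.
  - now apply Sigma0_add.
  - rewrite Nat.add_comm; now apply Sigma0_add.
Qed.

Lemma arith_imp R Q : arith R -> arith Q -> arith (fun p a => R p a -> Q p a).
Proof.
  intros HR HQ.
  eapply arith_iff; [|apply arith_not, (arith_and _ _ HR (arith_not _ HQ))].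
  intros p a; simpl; tauto.
Qed.

Lemma arith_ex (R : baire -> nat -> nat -> Prop) :
  arith (fun p b => R p (pr1 b) (pr2 b)) -> arith (fun p a => exists m, R p a m).
Proof.
  intros H; destruct (arith_not _ H) as [k HN].
  exists (S k); eexists; split; [exact HN|].
  intros p a; simpl; split.
  - intros [m Hm]; exists m; simpl_pr; tauto.
  - intros [m Hm]; exists m; revert Hm; simpl_pr; apply NNPP.
Qed.

Lemma arith_all (R : baire -> nat -> nat -> Prop) :
  arith (fun p b => R p (pr1 b) (pr2 b)) -> arith (fun p a => forall m, R p a m).
Proof.
  intros H.
  eapply arith_iff; [|apply arith_not, (arith_ex (fun p a m => ~ R p a m)),
    arith_not, H].
  intros p a; simpl; split.
  - intros N m; apply NNPP; eauto.
  - intros K [m Hm]; auto.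
Qed.

(** If [q] is only partially computable from [p], the decidable matrix turns
    into a halting statement about the composed program, which costs one
    quantifier. *)
Lemma Sigma0_oracle k R e : Sigma0 k R -> exists R', Sigma0 (S k) R'
  /\ forall p q, (forall n, eval p e n (q n)) -> forall a, R' p a <-> R q a.
Proof.
  revert R; induction k as [|k IH]; intros R.
  - intros [c Hc]; pose (d := subst e c).
    (* [feval] returns the successor of the value, so 2 stands for acceptance. *)
    exists (fun p a => exists s, feval (fun i => S (p i)) s d a = 2); split.
    + exists (fun p b => feval (fun i => S (p i)) (pr2 b) d (pr1 b) <> 2); split.
      * apply dec_not, dec_eq; auto with tc.
        eapply tc_ext; [|apply (tc_comp (tc_feval (o := fun p _ i => S (p i)) d
          (tc_succ (tc_query (tc_pr2 tc_id)))) (tc_pair (tc_pr2 tc_id) (tc_pr1 tc_id)))].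
        intros p b; simpl; now simpl_pr.
      * intros p a; split; intros [s Hs]; exists s; revert Hs; simpl_pr; lia.
    + intros p q He a.
      assert (K : forall r, eval q c a r -> eval p d a r) by now apply eval_subst.
      split.
      * intros [s Hs].
        apply feval_sound with (p := p) in Hs; [|now intros b v [= <-]].
        destruct (Hc q a) as [[HR _]|[_ H]]; [easy|].
        discriminate (eval_fun Hs (K _ H)).
      * intros HR; destruct (Hc q a) as [[_ H]|[N _]]; [|easy].
        destruct (feval_complete (K _ H)) as [s Hs]; exists s; apply Hs; auto.
  - intros (Q & HQ & E); destruct (IH Q HQ) as (Q' & HQ' & E').
    exists (fun p a => exists m, ~ Q' p (pr a m)); split.
    + exists Q'; easy.
    + intros p q He a; rewrite E.
      split; intros [m Hm]; exists m; now rewrite (E' p q He) in *.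
Qed.

Lemma arithmetical_of_oracle (e : code) R (F : pfun) : arith R ->
  (forall p f, F p f -> exists q, (forall n, eval p e n (q n))
     /\ forall n m, R q (pr n m) <-> f n = m) ->
  arithmetical F.
Proof.
  intros [k HR] H; destruct (Sigma0_oracle k R e HR) as (R' & HR' & E).
  exists (S k), R'; split; [easy|]; intros p f Hf n m.
  destruct (H p f Hf) as (q & Hq & Kq); now rewrite (E p q Hq).
Qed.

(** The graph of the sequence itself is decidable in that sequence. *)
Lemma arithmetical_of_computable F : computable F -> arithmetical F.
Proof.
  intros [c Hc]; apply (arithmetical_of_oracle c (fun q a => q (pr1 a) = pr2 a)).
  - apply arith_dec, dec_eq; auto with tc.
  - intros p f Hf; exists f; split; [now apply Hc|].
    intros n m; now simpl_pr.
Qed.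

Lemma arith_extendible (U : baire -> list nat -> Prop) F :
  dec (fun p a => U p (decode a)) -> tc F ->
  arith (fun p a => extendible (U p) (decode (F p a))).
Proof.
  intros HU HF.
  eapply arith_iff; [|apply (arith_all (fun p a m => exists t,
    m <= length (decode t) /\ U p (decode t)
    /\ firstn (length (decode (F p a))) (decode t) = decode (F p a)))].
  - intros p a; simpl; split; intros H m; destruct (H m) as [t Ht].
    + eauto.
    + exists (encode t); now rewrite decode_encode.
  - apply (arith_ex (fun p b t => pr2 b <= length (decode t) /\ U p (decode t)
      /\ firstn (length (decode (F p (pr1 b)))) (decode t) = decode (F p (pr1 b)))).
    assert (HF1 : tc (fun p b => F p (pr1 (pr1 b))))
      by (apply (tc_comp HF); auto with tc).
    apply arith_dec, dec_and; [apply dec_le; auto with tc; apply tc_length; auto with tc|].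
    apply dec_and; [apply (dec_subst _ _ HU); auto with tc|].
    apply dec_list_eq; [apply tc_firstn; auto with tc; now apply tc_length|].
    eapply tc_ext; [|exact HF1]; intros p a; now rewrite encode_decode.
Qed.

Lemma arith_least_child (E : baire -> list nat -> Prop) F G :
  arith (fun p a => E p (decode a)) -> tc F -> tc G ->
  arith (fun p a => least_child (E p) (decode (F p a)) (G p a)).
Proof.
  intros HE HF HG.
  apply arith_and.
  - eapply arith_iff; [|apply (arith_arg _ _ HE (tc_snoc _ _ HF HG))].
    intros p a; simpl; now rewrite decode_encode.
  - apply (arith_all (fun p a y => y < G p a -> ~ E p (decode (F p a) ++ [y]))).
    apply arith_imp.
    + apply arith_dec, dec_le; auto with tc; apply (tc_comp HG); auto with tc.
    + apply arith_not.
      eapply arith_iff; [|apply (arith_arg _ (fun p b =>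
        encode (decode (F p (pr1 b)) ++ [pr2 b])) HE)].
      * intros p a; simpl; now rewrite decode_encode.
      * apply tc_snoc; auto with tc; apply (tc_comp HF); auto with tc.
Qed.

Lemma arith_leftmost (E : baire -> list nat -> Prop) :
  arith (fun p a => E p (decode a)) ->
  exists R, arith R /\ forall p f, leftmost (E p) f ->
    forall n m, R p (pr n m) <-> f n = m.
Proof.
  intros HE.
  exists (fun p a => exists u, pr1 a < length (decode u)
    /\ nth (pr1 a) (decode u) 0 = pr2 a
    /\ forall i, i < length (decode u) ->
         least_child (E p) (decode (encode (firstn i (decode u)))) (nth i (decode u) 0)).
  split.
  - apply (arith_ex (fun p a u => pr1 a < length (decode u)
    /\ nth (pr1 a) (decode u) 0 = pr2 a
    /\ forall i, i < length (decode u) ->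
         least_child (E p) (decode (encode (firstn i (decode u)))) (nth i (decode u) 0))).
    apply arith_and; [apply arith_dec, dec_le; auto with tc; apply tc_length; auto with tc|].
    apply arith_and; [apply arith_dec, dec_eq; auto with tc; apply tc_nth; auto with tc|].
    apply (arith_all (fun p b i => i < length (decode (pr2 b)) ->
      least_child (E p) (decode (encode (firstn i (decode (pr2 b)))))
        (nth i (decode (pr2 b)) 0))).
    apply arith_imp; [apply arith_dec, dec_le; auto with tc; apply tc_length; auto with tc|].
    apply (arith_least_child E); auto.
    + apply tc_firstn; auto with tc.
    + apply tc_nth; auto with tc.
  - intros p f Hf n m; rewrite <- (leftmost_value (E p) f n m Hf); simpl_pr.
    split.
    + intros (u & L & En & H); exists (decode u); split; [easy|split; [easy|]].
      intros i Li; specialize (H i Li); now rewrite decode_encode in H.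
    + intros (u & H); exists (encode u); rewrite decode_encode.
      destruct H as (L & En & H); split; [easy|split; [easy|]].
      intros i Li; rewrite decode_encode; auto.
Qed.

(** * Closed sets in Cantor space *)

(** The tree consists of the binary sequences on which the program that decides
    [R], run through its associate, has not yet rejected any argument up to their
    length. *)
Lemma closed_class_tree (R : baire -> nat -> Prop) : dec R ->
  exists e, forall z, exists r (B : binary_tree_space),
    (forall n, eval z e n (r n)) /\ names r B
    /\ forall X : baire, path (proj1_sig B) X <->
         (forall n, X n < 2) /\ forall n, R (bpair z X) n.
Proof.
  intros [c Hc].
  pose (ans z k n s := curry_assoc c z (pr n (encode (firstn k s)))).
  (* Only the first answer of an associate counts; the answer 1 stands for the
     value 0, which is a rejection. *)
  pose (W z s := (forall i, i < length s -> nth i s 0 < 2)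
    /\ forall k, k < S (length s) -> forall n, n < S (length s) ->
         ans z k n s = 1 -> exists j, j < k /\ ans z j n s <> 0).
  assert (HW : dec (fun z a => W z (decode a))).
  { assert (Hans : forall K N F, tc K -> tc N -> tc F ->
      tc (fun z a => ans z (K z a) (N z a) (decode (F z a)))).
    { intros K N F HK HN HF; destruct (curry_assoc_computable c) as [d Hd].
      assert (H : tc (curry_assoc c)) by (exists d; apply Hd).
      apply (tc_comp H (tc_pair HN (tc_firstn _ _ HF HK))). }
    apply dec_and.
    - apply (dec_all _ (fun z a i => nth i (decode a) 0 < 2));
        [apply tc_length; auto with tc|].
      apply dec_le; auto with tc; apply tc_succ, tc_nth; auto with tc.
    - apply (dec_all _ (fun z a k => forall n, n < S (length (decode a)) ->
         ans z k n (decode a) = 1 -> exists j, j < k /\ ans z j n (decode a) <> 0));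
        [apply tc_succ, tc_length; auto with tc|].
      apply (dec_all _ (fun z b n =>
         ans z (pr2 b) n (decode (pr1 b)) = 1 -> exists j, j < pr2 b /\ ans z j n (decode (pr1 b)) <> 0));
        [apply tc_succ, tc_length; auto with tc|].
      apply dec_imp; [apply dec_eq; auto with tc|].
      apply (dec_ex _ (fun z b j => ans z j (pr2 b) (decode (pr1 (pr1 b))) <> 0));
        auto with tc.
      apply dec_not, dec_eq; auto with tc. }
  assert (ans_firstn : forall z k n j s, k <= j -> ans z k n (firstn j s) = ans z k n s).
  { intros z k n j s L; unfold ans; rewrite firstn_firstn; do 4 f_equal; lia. }
  assert (TW : forall z, is_tree (W z) /\ forall s, W z s -> Forall (fun i => i < 2) s).
  { intros z; split.
    - intros s t [HB HA]; rewrite length_app in HB, HA; split.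
      + intros i L; specialize (HB i ltac:(lia)); now rewrite app_nth1 in HB by lia.
      + assert (E : forall k n, k <= length s -> ans z k n s = ans z k n (s ++ t)).
        { intros k n L; rewrite <- (ans_firstn z k n (length s)) by easy.
          rewrite <- (ans_firstn z k n (length s) (s ++ t)) by easy.
          now rewrite firstn_app, Nat.sub_diag, app_nil_r. }
        intros k Lk n Ln; rewrite E by lia; intros A.
        destruct (HA k ltac:(lia) n ltac:(lia) A) as (j & Lj & Hj).
        exists j; rewrite E by lia; easy.
    - intros s [HB _]; apply Forall_nth; intros i d L.
      rewrite nth_indep with (d' := 0) by easy; auto. }
  destruct HW as [e He]; exists e; intros z.
  exists (fun n => if excluded_middle_informative (W z (decode n)) then 1 else 0),
    (exist _ (W z) (TW z)); split; [|split].
  - intros n; destruct excluded_middle_informative;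
      destruct (He z n) as [[]|[]]; easy.
  - intros s; simpl; rewrite decode_encode.
    now destruct excluded_middle_informative.
  - intros X; simpl.
    assert (A : forall n, exists k,
      ans z k n (prefix X k) = S (if excluded_middle_informative (R (bpair z X) n) then 1 else 0)
      /\ forall j, j < k -> ans z j n (prefix X j) = 0).
    { intros n.
      destruct (curry_assoc_spec (c := c) (p := z) (q := X)
        (r := fun n => if excluded_middle_informative (R (bpair z X) n) then 1 else 0))
        with (n := n) as (k & Hk & Lk).
      - intros m; destruct excluded_middle_informative;
          destruct (Hc (bpair z X) m) as [[]|[]]; easy.
      - exists k; unfold ans; rewrite firstn_prefix by lia; split; [exact Hk|].
        intros j L; rewrite firstn_prefix by lia; now apply Lk. }
    assert (E : forall k n j, k <= j -> ans z k n (prefix X j) = ans z k n (prefix X k)).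
    { intros k n j L; unfold ans; now rewrite !firstn_prefix by lia. }
    split.
    + intros P; split.
      * intros n; destruct (P (S n)) as [HB _]; rewrite length_prefix in HB.
        specialize (HB n ltac:(lia)); now rewrite nth_prefix in HB by lia.
      * intros n; destruct (A n) as (k & Hk & Lk).
        destruct excluded_middle_informative as [|N]; [easy|exfalso].
        destruct (P (k + n)) as [_ HA]; rewrite length_prefix in HA.
        destruct (HA k ltac:(lia) n ltac:(lia)) as (j & Lj & Hj).
        -- now rewrite E by lia.
        -- apply Hj; rewrite E by lia; now apply Lk.
    + intros [HB HR] m; split; rewrite length_prefix.
      * intros i L; rewrite nth_prefix by easy; apply HB.
      * intros k Lk n Ln; rewrite E by lia; intros Hk.
        destruct (A n) as (k0 & Hk0 & Lk0).
        destruct excluded_middle_informative as [_|N]; [|now destruct N].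
        destruct (Nat.lt_trichotomy k k0) as [L|[->|L]].
        -- rewrite Lk0 in Hk; easy.
        -- congruence.
        -- exists k0; split; [easy|]; rewrite E by lia; congruence.
Qed.

(** * The reduction *)

Definition tree_of (p : baire) (s : list nat) : Prop := p (encode s) = 1.

Definition evens (z : baire) : baire := fun n => z (2 * n).
Definition odds (z : baire) : baire := fun n => z (S (2 * n)).

Lemma evens_bpair p q : evens (bpair p q) = p.
Proof. apply functional_extensionality; intros n; apply bpair_l. Qed.

Lemma odds_bpair p q : odds (bpair p q) = q.
Proof. apply functional_extensionality; intros n; apply bpair_r. Qed.

Lemma tc_evens (F : baire -> baire) : tc F -> tc (fun z => evens (F z)).
Proof. intros H; apply (tc_comp H); auto with tc. Qed.

Lemma tc_odds (F : baire -> baire) : tc F -> tc (fun z => odds (F z)).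
Proof. intros H; apply (tc_comp H); auto with tc. Qed.

Lemma tc_oracle : tc (fun z => z).
Proof. apply tc_query, tc_id. Qed.

Lemma dec_tree_of (P : baire -> baire) : tc P ->
  dec (fun z a => tree_of (P z) (decode a)).
Proof.
  intros HP; apply dec_eq; auto with tc; apply (tc_comp HP).
  eapply tc_ext; [|apply tc_id]; intros p a; now rewrite encode_decode.
Qed.

Lemma names_tree p (T : tree_space) : names p T -> proj1_sig T = tree_of p.
Proof.
  intros H; apply pred_ext; intros s; destruct (H s) as [H1 H0].
  unfold tree_of; split; [auto|]; intros E; apply NNPP; intros N.
  rewrite (H0 N) in E; discriminate.
Qed.

Lemma enumeration_code (R : baire -> nat -> Prop) : dec R ->
  exists e, forall p, exists q, (forall n, eval p e n (q n))
    /\ enumerates q (fun s => R p (encode s)).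
Proof.
  intros HR; destruct (dec_indicator _ HR) as (F & HF & E).
  destruct (tc_if HF (tc_succ tc_id) (tc_const 0)) as [e He].
  exists e; intros p; eexists; split; [intros n; apply He|].
  intros s; rewrite <- E; split.
  - intros H; exists (encode s); now rewrite H.
  - intros [i Hi]; destruct (F p i) eqn:Fi; [|easy].
    injection Hi as ->; exact Fi.
Qed.

Lemma dead_open_code : exists e, forall p, exists q (A : open_space),
  (forall n, eval p e n (q n)) /\ names q A
  /\ proj1_sig A = generated_open (dead (tree_of p)).
Proof.
  destruct (enumeration_code (fun p a => dead (tree_of p) (decode a))) as [e He].
  - apply dec_dead; auto with tc; apply (dec_tree_of (fun z => z)), tc_oracle.
  - exists e; intros p; destruct (He p) as (q & Hq & Eq).
    exists q, (exist _ (generated_open (dead (tree_of p))) (ex_intro _ _ eq_refl)).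
    split; [exact Hq|split; [|easy]].
    exists (dead (tree_of p)); split; [|easy].
    intros s; rewrite <- (Eq s); now rewrite decode_encode.
Qed.

Definition homogeneous (L : laver_space) (A : baire -> Prop) : Prop :=
  (forall g, path (proj1_sig L) g -> A g)
  \/ (forall g, path (proj1_sig L) g -> ~ A g).

(** The prefix of the path is itself a node below the prefix of the bound. *)
Lemma dominated_not_dead T f g : path T f -> (forall n, f n <= g n) ->
  ~ generated_open (dead T) g.
Proof.
  intros Hf Hg [n D]; apply (D (prefix f n)); [|apply Hf].
  apply Forall2_le_prefix; rewrite length_prefix; split; [easy|].
  intros i L; now rewrite nth_prefix.
Qed.

Lemma laver_dominates (L : laver_space) (f : baire) :
  exists g, path (proj1_sig L) g /\ forall n, f n <= g n.
Proof.
  destruct L as [L (HT & H0 & HS)]; simpl.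
  destruct (branch_exists L (fun s x => f (length s) <= x /\ L (s ++ [x])))
    as (g & Pg & Hg); auto.
  - now intros s x [_ H].
  - exists g; split; [easy|]; intros n; destruct (Hg n) as [H _].
    now rewrite length_prefix in H.
Qed.

(** The open sets of dead prefixes have an explicit dichotomy: a path of [T] shows
    how to avoid the open set, and without a path Koenig's lemma puts every
    sequence into it. *)
Lemma homogeneous_exists T : is_tree T ->
  exists L, homogeneous L (generated_open (dead T)).
Proof.
  intros HT; destruct (classic (exists f, path T f)) as [[f Hf]|N].
  - assert (HL : is_laver_tree (fun s => forall i, i < length s -> f i <= nth i s 0)).
    { split; [|split].
      - intros s t H i L; specialize (H i).
        rewrite length_app, app_nth1 in H by lia; apply H; lia.
      - simpl; lia.
      - intros s Hs m; exists (m + f (length s)); split; [lia|].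
        intros i L; rewrite length_app in L; simpl in L.
        destruct (Nat.eq_dec i (length s)) as [->|Ni].
        + rewrite app_nth2, Nat.sub_diag by lia; simpl; lia.
        + rewrite app_nth1 by lia; apply Hs; lia. }
    exists (exist _ _ HL); right; simpl; intros g Hg.
    apply dominated_not_dead with (f := f); auto.
    intros n; specialize (Hg (S n) n); rewrite length_prefix, nth_prefix in Hg by lia.
    apply Hg; lia.
  - assert (HL : is_laver_tree (fun _ => True)) by (repeat split; eauto).
    exists (exist _ _ HL); left; intros g _; apply NNPP; intros D.
    destruct (trunk_branch T g HT) as (f & Hf & _).
    apply N; exists f; apply (path_trunk T g f Hf).
    intros n Dn; apply D; now exists n.
Qed.

(** Homogeneity carries the information from one path of the Laver tree, which
    dominates a path of [T], to every other path. *)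
Lemma trunk_path_solves T (L : laver_space) g f :
  homogeneous L (generated_open (dead T)) -> path (proj1_sig L) g ->
  path (trunk T g) f -> (exists h, path T h) -> path T f.
Proof.
  intros HL Hg Hf [h Hh]; apply (path_trunk T g f Hf); intros n D.
  destruct HL as [HL|HL].
  - destruct (laver_dominates L h) as (g' & Hg' & Lg').
    exact (dominated_not_dead T h g' Hh Lg' (HL g' Hg')).
  - apply (HL g Hg); now exists n.
Qed.

(** The coding is computably translated to characteristic functions, and from these
    the leftmost path is found by search. *)
Lemma laver_path_code LT : is_laver_coding LT -> exists e, forall q, exists g,
  path (proj1_sig (LT q)) g /\ forall n, eval q e n (g n).
Proof.
  intros (_ & _ & [F [[c Hc] HF]] & _).
  destruct leftmost_code as [d Hd].
  exists (subst c d); intros q.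
  destruct (HF q (LT q) eq_refl) as (l & Hl & Nl).
  pose proof (proj2_sig (LT q)) as (_ & H0 & HS).
  destruct (leftmost_exists (proj1_sig (LT q))) as (g & Pg & Lg); auto.
  - intros s Hs; destruct (HS s Hs 0) as (x & _ & Hx); eauto.
  - exists g; split; [easy|]; intros n.
    apply eval_subst with (q := l); [now apply Hc|].
    apply (Hd l (proj1_sig (LT q))); auto; intros s; apply (Nl s).
Qed.

(** Counting ones makes every binary sequence [X] the code of a sequence bounded by
    [g], so that a bounded closed set pulls back to a closed set of binary sequences
    without further conditions on [X]. *)
Definition row_sums (g X : baire) : baire :=
  fun i => list_sum (map (fun j => X (pr i j)) (seq 0 (g i))).

Lemma row_sums_onto (g f : baire) : (forall n, f n <= g n) ->
  exists X : baire, (forall n, X n < 2) /\ row_sums g X = f.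
Proof.
  intros H; exists (fun a => if pr2 a <? f (pr1 a) then 1 else 0); split.
  - intros n; destruct (_ <? _); lia.
  - apply functional_extensionality; intros i; unfold row_sums.
    assert (K : forall k, list_sum (map (fun j =>
      if pr2 (pr i j) <? f (pr1 (pr i j)) then 1 else 0) (seq 0 k)) = Nat.min k (f i)).
    { intros k; induction k as [|k IH]; [easy|].
      rewrite seq_S, map_app, list_sum_app, IH; cbn [map list_sum fold_right Nat.add].
      simpl_pr; destruct (Nat.ltb_spec k (f i)); lia. }
    rewrite K; specialize (H i); lia.
Qed.

Lemma tc_row_sums (G X : baire -> baire) : tc G -> tc X ->
  tc (fun z => row_sums (G z) (X z)).
Proof.
  intros HG HX; apply (tc_sum G (fun z i j => X z (pr i j)) HG).
  apply (tc_comp HX); auto with tc.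
Qed.

Lemma trunk_tree_code : exists e, forall p g, exists r (B : binary_tree_space),
  (forall n, eval (bpair p g) e n (r n)) /\ names r B
  /\ forall X : baire, path (proj1_sig B) X <->
       (forall n, X n < 2) /\ path (trunk (tree_of p) g) (row_sums g X).
Proof.
  destruct (closed_class_tree (fun w n =>
    trunk (tree_of (evens (evens w))) (odds (evens w))
      (decode (encode (prefix (row_sums (odds (evens w)) (odds w)) n))))) as [e He].
  - assert (HE : tc (fun w => evens w)) by apply (tc_evens _ tc_oracle).
    assert (HO : tc (fun w => odds (evens w))) by now apply tc_odds.
    apply (dec_trunk (fun w => tree_of (evens (evens w))) (fun w => odds (evens w))).
    + apply (dec_tree_of (fun w => evens (evens w))); now apply tc_evens.
    + exact HO.
    + apply tc_prefix_at; auto with tc; apply tc_row_sums; [exact HO|].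
      apply (tc_odds _ tc_oracle).
  - exists e; intros p g; destruct (He (bpair p g)) as (r & B & Hr & HS & HX).
    exists r, B; split; [easy|split; [easy|]].
    intros X; rewrite HX, evens_bpair, evens_bpair, !odds_bpair.
    split; intros [HB H]; (split; [easy|]); intros n; specialize (H n);
      now rewrite decode_encode in *.
Qed.

(** The associate in the instance maps a code of a Laver tree to the binary tree of
    the trunk below its leftmost path. To read off the answer, that leftmost path
    is computed once more, from the intermediate solution. *)
Lemma TC_le_comp_product LT : is_laver_coding LT ->
  TC_baire ≤W C_cantor ⋆ LL_Sigma01 LT.
Proof.
  intros hLT.
  destruct (laver_path_code LT hLT) as [b Hb], dead_open_code as [o Ho],
    trunk_tree_code as [t Ht], left_code as [cl Hl], right_code as [cr Hr].
  destruct (join_codes cl (subst cr b)) as [u Hu].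
  assert (Hu' : forall p q g, (forall n, eval q b n (g n)) ->
    forall n, eval (bpair p q) u n (bpair p g n)).
  { intros p q g Hg; apply Hu; [apply Hl|].
    intros n; apply eval_subst with (q := q); auto. }
  destruct (curry_assoc_computable (subst u t)) as [a Ha].
  destruct (join_codes a o) as [c Hc].
  destruct (join_codes (subst (subst cr cl) b) (subst cr cr)) as [v Hv].
  destruct (tc_row_sums _ _ (tc_evens _ tc_oracle) (tc_odds _ tc_oracle)) as [w Hw].
  apply le_W_pointwise; exists c, (subst v w); intros p T HpT _.
  pose proof (proj2_sig T) as TT; pose proof (names_tree p T HpT) as ET.
  destruct (Ho p) as (p' & A & Hp' & HA & EA).
  pose (asc := curry_assoc (subst u t) p).
  assert (K : forall q, exists r (B : binary_tree_space) g,
    assoc_app asc q r /\ names r B /\ mvdom C_cantor B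
    /\ path (proj1_sig (LT q)) g /\ (forall n, eval q b n (g n))
    /\ forall X, path (proj1_sig B) X -> path (trunk (proj1_sig T) g) (row_sums g X)).
  { intros q; destruct (Hb q) as (g & Pg & Hg).
    destruct (Ht p g) as (r & B & Hr' & HS & HX).
    exists r, B, g; split; [|split; [easy|split; [|split; [easy|split; [easy|]]]]].
    - apply curry_assoc_spec; intros n.
      apply eval_subst with (q := bpair p g); auto.
    - destruct (trunk_branch (tree_of p) g) as (f & Hf & _).
      { rewrite <- ET; exact TT. }
      destruct (row_sums_onto g f) as (X & BX & EX).
      { intros n; now apply (path_trunk_le (tree_of p)). }
      exists (exist _ X BX); apply HX; simpl; rewrite EX; auto.
    - intros X PX; rewrite ET; now apply HX. }
  exists (bpair asc p'), (asc, A); split; [now apply Hc|split; [|split]].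
  - exists asc, p'; simpl; auto.
  - assert (D : forall q, exists r B,
      assoc_app asc q r /\ names r B /\ mvdom C_cantor B)
      by (intros q; destruct (K q) as (r & B & g & H); exists r, B; tauto).
    destruct (homogeneous_exists (proj1_sig T) TT) as [L HL].
    destruct (proj1 (proj2 hLT) L) as [q Eq].
    destruct (D q) as (r & B & H1 & H2 & X & HX).
    exists (q, X); split; [intros q' _ _ _; apply D|].
    exists q, r, B; split; [easy|split; [|auto]].
    simpl; unfold LL_Sigma01; rewrite Eq, EA, <- ET; exact HL.
  - intros qX [q X] (q' & X' & -> & Hq & HX') (_ & q1 & r & B & H1 & HL & HS & Hr' & PX).
    simpl in Hq, HX', H1; subst q' X' q1.
    destruct (K q) as (r' & B' & g & H2 & H3 & _ & Pg & Hg & HX).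
    pose proof (graph_fun (p0 := assoc_app asc) H2 HS); subst r'.
    pose proof (names_fun H3 Hr'); subst B'.
    exists (row_sums g (proj1_sig X)), (row_sums g (proj1_sig X)).
    split; [|split; [easy|]].
    + intros n; apply eval_subst with (q := bpair g (proj1_sig X)).
      * apply Hv.
        -- intros k; apply eval_subst with (q := q); [|apply Hg].
           intros j; apply eval_subst with (q := bpair q (proj1_sig X)); auto.
        -- intros k; apply eval_subst with (q := bpair q (proj1_sig X)); auto.
      * specialize (Hw (bpair g (proj1_sig X)) n).
        now rewrite evens_bpair, odds_bpair in Hw.
    + unfold TC_baire; apply (trunk_path_solves _ (LT q) g); auto.
      rewrite ET, <- EA; exact HL.
Qed.

Lemma leftmost_unique E f f' : leftmost E f -> leftmost E f' -> f = f'.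
Proof.
  intros H H'; apply functional_extensionality; intros n.
  apply (leftmost_value E f n (f' n) H), (leftmost_value E f' n (f' n) H'); easy.
Qed.

(** The forward map is the computable one from above; only the choice of a path of
    the trunk goes beyond computability. *)
Lemma TC_le_arithmetical LT : is_laver_coding LT -> TC_baire ≤aW LL_Sigma01 LT.
Proof.
  intros hLT.
  destruct (laver_path_code LT hLT) as [b Hb], dead_open_code as [o Ho],
    left_code as [cl Hl], right_code as [cr Hr].
  destruct (join_codes cl (subst cr b)) as [u Hu].
  pose (E z := extendible (trunk (tree_of (evens z)) (odds z))).
  assert (F : forall p f f',
    (exists z, (forall n, eval p u n (z n)) /\ leftmost (E z) f) ->
    (exists z, (forall n, eval p u n (z n)) /\ leftmost (E z) f') -> f = f').
  { intros p f f' (z & Hz & Hf) (z' & Hz' & Hf').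
    assert (z = z') by
      (apply functional_extensionality; intros n; exact (eval_fun (Hz n) (Hz' n))).
    subst z'; exact (leftmost_unique (E z) f f' Hf Hf'). }
  exists (pfun_of_code o), (Pfun F); split; [|split].
  - apply arithmetical_of_computable, computable_of_code.
  - destruct (arith_leftmost E) as (R & HR & ER).
    + assert (HE : tc evens) by apply (tc_evens _ tc_oracle).
      apply (arith_extendible (fun z => trunk (tree_of (evens z)) (odds z)));
        auto with tc.
      apply (dec_trunk (fun z => tree_of (evens z))); auto with tc.
      * now apply dec_tree_of.
      * apply (tc_odds _ tc_oracle).
    + apply (arithmetical_of_oracle u R); [exact HR|].
      intros p f (z & Hz & Hf); exists z; split; [easy|]; now apply ER.
  - intros G HG p T HpT _.
    pose proof (proj2_sig T) as TT; pose proof (names_tree p T HpT) as ET.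
    destruct (Ho p) as (p' & A & Hp' & HA & EA).
    destruct (HG p' A HA) as (q & q' & HGq & Eq & HL).
    { destruct (homogeneous_exists (proj1_sig T) TT) as [L HL].
      destruct (proj1 (proj2 hLT) L) as [q Eq].
      exists q; unfold LL_Sigma01; rewrite Eq, EA, <- ET; exact HL. }
    simpl in Eq; subst q'.
    destruct (Hb q) as (g & Pg & Hg).
    destruct (trunk_branch (proj1_sig T) g TT) as (f & Pf & Lf).
    exists f, f; split; [|split; [easy|]].
    + exists p', q; split; [exact Hp'|split; [exact HGq|]].
      exists (bpair p g); split.
      * apply Hu; [apply Hl|]; intros n; apply eval_subst with (q := q); auto.
      * unfold E; now rewrite evens_bpair, odds_bpair, <- ET.
    + unfold TC_baire; apply (trunk_path_solves _ (LT q) g); auto.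
      rewrite ET, <- EA; exact HL.
Qed.

Theorem lemma5p12 (LT : baire -> laver_space) (hLT : is_laver_coding LT) :
  TC_baire ≤W C_cantor ⋆ LL_Sigma01 LT /\ TC_baire ≤aW LL_Sigma01 LT.
Proof.
  split; [now apply TC_le_comp_product|now apply TC_le_arithmetical].
Qed.
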